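(* Let $\lambda>0$ be such that $\|H_a\|\le\lambda$ and $\|V_a\|^2\le\lambda$ for every $a\in\mathcal A$. For all constants $c_0,C_0>0$ there is a constant $C>0$, depending only on $c_0$ and $C_0$ (in particular not on $N$, $\lambda$, $\tau$, $M$, the ensemble or the approximation scheme), such that the following holds. If $0<\tau\le c_0\lambda^{-1}$, if $$\|\mathcal F_\tau(\mathcal L_a)-e^{\tau\mathcal L_a}\|_\diamond\le C_0\lambda^2\tau^2\qquad\text{for all }a\in\mathcal A,$$ and if $T=\tau M$ with $M\ge1$ an integer, then $$\big\|\bar{\mathcal E}_{\tau,M}-e^{T\bar{\mathcal L}}\big\|_\diamond\le C\,\frac{\lambda^2T^2}{M}.$$
   Context: $\mathcal H$ is a Hilbert space of finite dimension $N=2^n$, $\mathcal B(\mathcal H)$ is the space of operators on it, $\|\cdot\|$ is the spectral norm, $\|X\|_1=\operatorname{Tr}\sqrt{X^\dagger X}$. A quantum channel is a completely positive trace-preserving linear map on $\mathcal B(\mathcal H)$. For a linear map $\Phi$ on $\mathcal B(\mathcal H)$, $\|\Phi\|_\diamond=\sup\{\|(\Phi\otimes\mathrm{id})X\|_1: X\in\mathcal B(\mathcal H\otimes\mathcal H),\ \|X\|_1=1\}$. $(\mathcal A,\mu)$ is a probability space. For each $a\in\mathcal A$, $H_a\in\mathcal B(\mathcal H)$ is Hermitian, $V_a\in\mathcal B(\mathcal H)$, and $$\mathcal L_a(\rho)=-i[H_a,\rho]+V_a\rho V_a^\dagger-\tfrac12\{V_a^\dagger V_a,\rho\},$$ with measurable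 dependence on $a$. Set $\bar{\mathcal L}=\int_{\mathcal A}\mathcal L_a\,d\mu(a)$. For each $a$, $\mathcal F_\tau(\mathcal L_a)$ is a quantum channel (depending measurably on $a$), thought of as an algorithmic approximation of $e^{\tau\mathcal L_a}$. The average channel is $\bar{\mathcal E}_{\tau,M}=\big(\mathbb E_{a\sim\mu}\mathcal F_\tau(\mathcal L_a)\big)^M$ ($M$-fold composition). *)

(* Defs.v *)
From HB Require Import structures.
From mathcomp Require Import all_boot all_order all_algebra.
From mathcomp Require Import all_classical all_reals all_analysis.
From mathcomp Require Import complex.
Set Implicit Arguments.
Unset Strict Implicit.
Unset Printing Implicit Defensive.
Import Order.TTheory GRing.Theory Num.Theory.
Import numFieldNormedType.Exports.
Local Open Scope classical_set_scope.
Local Open Scope ring_scope.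
Local Open Scope sesquilinear_scope.

Section Operators.
Variables (R : realType) (N : nat).
Implicit Types (A X : 'M[R[i]]_N) (v : 'cV[R[i]]_N).

Definition vnorm v : R := Num.sqrt (complex.Re ((v^t* *m v) 0 0)).

(* The spectral norm, as the operator norm for the Euclidean vector norm. The
   supremum is taken in \bar R, since the real-valued sup of an unbounded set
   is 0. *)
Definition opnorm A : \bar R :=
  ereal_sup [set (vnorm (A *m v))%:E | v in [set v | vnorm v = 1]].

(* R[i] is ordered by x <= y iff y - x is a nonnegative real, so this includes
   the requirement that the quadratic form be real, i.e. that A be Hermitian. *)
Definition psd A : Prop := forall v, 0 <= (v^t* *m A *m v) 0 0.

(* Meaningful for positive semidefinite A: square roots of the eigenvalues in
   an orthonormal eigenbasis. *)
Definition sqrtmx A : 'M[R[i]]_N :=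
  invmx (spectralmx A) *m diag_mx (map_mx sqrtC (spectral_diag A))
    *m spectralmx A.

Definition trnorm X : R := complex.Re (\tr (sqrtmx (X^t* *m X))).

End Operators.

(* Linearity is not part of the type. quantum_channel requires it, lindblad H V
   is visibly linear, and superop_exp and superop_mean inherit it from linear
   (for the mean, also integrable) arguments. *)
Definition superop (R : realType) (N : nat) := 'M[R[i]]_N -> 'M[R[i]]_N.

Section Superoperators.
Variables (R : realType) (N : nat).
Implicit Types (Phi : superop R N) (X : 'M[R[i]]_N).

(* Phi tensored with the identity of the k x k matrices. A matrix on the tensor
   product of C^N and C^k is a k x k array of N x N blocks, the block indices
   being those of the C^k factor, and Phi acts on each block. *)
Definition ampliation (k : nat) Phi : superop R (\sum_(_ < k) N) :=
  fun X : 'M[R[i]]_(\sum_(_ < k) N) =>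
    \mxblock_(i < k, j < k) Phi (submxblock X i j).

Definition completely_positive Phi : Prop :=
  forall (k : nat) (X : 'M[R[i]]_(\sum_(_ < k) N)),
    psd X -> psd (@ampliation k Phi X).

Definition trace_preserving Phi : Prop := forall X, \tr (Phi X) = \tr X.

Definition quantum_channel Phi : Prop :=
  [/\ linear Phi, completely_positive Phi & trace_preserving Phi].

Definition diamond_norm Phi : \bar R :=
  ereal_sup [set (trnorm (@ampliation N Phi X))%:E | X in
               [set X : 'M[R[i]]_(\sum_(_ < N) N) | trnorm X = 1]].

(* The regular module R[i]^o is the copy of R[i] that carries the topology. *)
Definition superop_exp Phi : superop R N :=
  fun X => limn (series
    (fun k => (k`!%:R^-1 : R[i]) *: iter k Phi X : 'M[R[i]^o]_N)).

Definition evolution (t : R) Phi : superop R N :=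
  superop_exp (t%:C%C \*: Phi).

Definition lindblad (H V : 'M[R[i]]_N) : superop R N := fun rho =>
  - 'i *: (H *m rho - rho *m H) + V *m rho *m V^t*
  - 2^-1 *: (V^t* *m V *m rho + rho *m (V^t* *m V)).

Section Ensembles.
Variables (d : measure_display) (A : measurableType d).

Definition measurable_superop (Phi : A -> superop R N) : Prop :=
  forall X i j,
    measurable_fun [set: A] (fun a => complex.Re (Phi a X i j)) /\
    measurable_fun [set: A] (fun a => complex.Im (Phi a X i j)).

Definition superop_mean (mu : probability A R) (Phi : A -> superop R N) :
    superop R N := fun X => \matrix_(i, j)
  ((\int[mu]_a complex.Re (Phi a X i j)) +i*
   (\int[mu]_a complex.Im (Phi a X i j)))%C.

End Ensembles.
End Superoperators.

(* Main.v *)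
(* Write every channel amplified to C^N (x) C^N and telescope
   A^M - B^M = sum_j A^(M-1-j) (A - B) B^j with A = E F_tau a contraction and
   B = (1 + tau Lbar/m)^m. The remainders F_tau(L_a) - 1 - tau L_a are
   O(lambda^2 tau^2) for every a, measurable in a, and keep this bound under
   averaging, because the trace norm is a supremum of real linear functionals
   X |-> Re tr (W X).
   Powers of B stay bounded for m large: with K = -iH - V^*V/2,
     1 + s L = (1 + sK) . (1 + sK)^* + s V . V^* - s^2 K . K^*,
   and the Kraus part scales the trace by at most 1 + O(s^2 lambda^2), so that
   ||1 + s L|| <= 1 + O(s^2 lambda^2). Finally (1 + T Lbar/(mM))^(mM) tends to
   e^(T Lbar), by comparing coefficients with the scalar exponential.
   The trace norm itself is handled through ||X||_1 = min (tr P + tr Q)/2 over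
   positive semidefinite [[P, X], [X^*, Q]], which makes complete positivity
   directly applicable. *)
Require Import Defs.
From HB Require Import structures.
From mathcomp Require Import all_boot all_order all_algebra.
From mathcomp Require Import all_classical all_reals all_analysis.
From mathcomp Require Import complex.
From mathcomp Require Import ring lra.
Set Implicit Arguments.
Unset Strict Implicit.
Unset Printing Implicit Defensive.
Import Order.TTheory GRing.Theory Num.Theory.
Import numFieldNormedType.Exports.
Local Open Scope classical_set_scope.
Local Open Scope ring_scope.
Local Open Scope sesquilinear_scope.

(** The comparison runs through an Euler product because no contraction property of [e^(tau Lbar)]
    is at hand: [Lbar] is an average and comes without a Kraus form of its own. The one-step
    inequality [||X + s L_a X||_1 <= (1 + 6 lambda^2 s^2) ||X||_1], on the other hand, passes
    through the average directly. It is essential that its excess is of second order in [s]. Over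
    [m M] steps of length [tau / m] the excesses add up to [6 lambda^2 tau^2 M / m], which a large
    [m] makes at most 1, whatever the total time. The crude growth [1 + 8 lambda s] would leave a
    factor [exp (8 lambda T)], and [lambda T] is not controlled by [c0]. The second order comes from
    the cancellation [K + K^* + V^* V = 0], which is visible only if both Kraus terms are estimated
    together. *)

Local Notation conjC := Num.conj.

(** * Positive block matrices *)

Section Adjoint.
Variable C : numClosedFieldType.

Lemma adjmxM m n p (A : 'M[C]_(m, n)) (B : 'M[C]_(n, p)) :
  (A *m B)^t* = B^t* *m A^t*.
Proof. by rewrite trmx_mul map_mxM. Qed.

Lemma adjmxD m n (A B : 'M[C]_(m, n)) : (A + B)^t* = A^t* + B^t*.
Proof. by rewrite linearD map_mxD. Qed.

Lemma adjmxN m n (A : 'M[C]_(m, n)) : (- A)^t* = - A^t*.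
Proof. by rewrite linearN map_mxN. Qed.

Lemma adjmxZ m n c (A : 'M[C]_(m, n)) : (c *: A)^t* = conjC c *: A^t*.
Proof. by rewrite linearZ map_mxZ. Qed.

Lemma adjmx1 n : (1%:M : 'M[C]_n)^t* = 1%:M.
Proof. by rewrite trmx1 map_mx1. Qed.

Lemma adjmx_diag n (s : 'rV[C]_n) : (diag_mx s)^t* = diag_mx (map_mx conjC s).
Proof. by rewrite tr_diag_mx map_diag_mx. Qed.

Lemma mul_diag_mx2 n (s t : 'rV[C]_n) :
  diag_mx s *m diag_mx t = diag_mx (\row_j (s 0 j * t 0 j)).
Proof.
by rewrite mul_diag_mx; apply/matrixP=> i j; rewrite !mxE mulrnAr.
Qed.

Lemma mxtrace_adj n (A : 'M[C]_n) : \tr (A^t*) = conjC (\tr A).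
Proof. by rewrite /mxtrace rmorph_sum; apply: eq_bigr => i _; rewrite !mxE. Qed.

Lemma mxtrace_mul_adj m n (A : 'M[C]_(m, n)) :
  \tr (A *m A^t*) = \sum_i \sum_j `|A i j| ^+ 2.
Proof.
apply: eq_bigr => i _; rewrite mxE; apply: eq_bigr => j _.
by rewrite !mxE normCK.
Qed.

Lemma mxtrace_mul_adj_ge0 m n (A : 'M[C]_(m, n)) : 0 <= \tr (A *m A^t*).
Proof.
by rewrite mxtrace_mul_adj; apply: sumr_ge0 => i _; apply: sumr_ge0 => j _;
  exact: exprn_ge0.
Qed.

Lemma mxtrace_mul_adj_eq0 m n (A : 'M[C]_(m, n)) :
  \tr (A *m A^t*) = 0 -> A = 0.
Proof.
rewrite mxtrace_mul_adj => /eqP.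
rewrite psumr_eq0; last by move=> i _; apply: sumr_ge0 => j _; exact: exprn_ge0.
move=> /allP A0; apply/matrixP=> i j; rewrite mxE; apply/eqP.
have /eqP := A0 i (mem_index_enum _).
move/eqP; rewrite psumr_eq0; last by move=> k _; exact: exprn_ge0.
by move=> /allP /(_ j (mem_index_enum _)); rewrite sqrf_eq0 normr_eq0.
Qed.

End Adjoint.

Section PositiveBlocks.
Variable C : numClosedFieldType.

(* The block matrix [[P, X], [X^*, Q]] is positive semidefinite. *)
Definition psd2 n (P X Q : 'M[C]_n) := forall u w : 'cV[C]_n,
  0 <= (u^t* *m P *m u + u^t* *m X *m w
        + w^t* *m X^t* *m u + w^t* *m Q *m w) 0 0.

Lemma mxtrace_col m n (Z1 Z2 : 'M[C]_(m, n)) (P : 'M[C]_m) :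
  \tr (Z1^t* *m P *m Z2) = \sum_k ((col k Z1)^t* *m P *m col k Z2) 0 0.
Proof.
apply: eq_bigr => k _.
have -> : (col k Z1)^t* = row k (Z1^t*) by apply/matrixP=> i j; rewrite !mxE.
rewrite -!row_mul [RHS]mxE [LHS]mxE [RHS]mxE.
by apply: eq_bigr => j _; congr (_ * _); rewrite [RHS]mxE.
Qed.

Lemma psd2_mxtrace n k (P X Q : 'M[C]_n) (Z1 Z2 : 'M[C]_(n, k)) :
  psd2 P X Q ->
  0 <= \tr (Z1^t* *m P *m Z1) + \tr (Z1^t* *m X *m Z2)
       + \tr (Z2^t* *m X^t* *m Z1) + \tr (Z2^t* *m Q *m Z2).
Proof.
move=> h; rewrite !mxtrace_col -!big_split /=.
by apply: sumr_ge0 => i _; have := h (col i Z1) (col i Z2); rewrite !mxE.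
Qed.

(** The three blocks are those of the column [[S; T]] times its adjoint. *)
Lemma psd2_mul_adj n k (S T : 'M[C]_(n, k)) :
  psd2 (S *m S^t*) (S *m T^t*) (T *m T^t*).
Proof.
move=> u w; have := mxtrace_mul_adj_ge0 ((S^t* *m u + T^t* *m w)^t*).
rewrite trmxCK trace_mx11; congr (0 <= fun_of_matrix _ _ _).
rewrite !(adjmxD, adjmxM, trmxCK) !(mulmxDl, mulmxDr) !mulmxA !addrA.
by congr (_ + _); rewrite -!addrA; congr (_ + _); rewrite addrC.
Qed.

(** [W^* W] is self-adjoint, so idempotence makes it an orthogonal projection. These operators are
    enough to attain the trace norm by duality, and the condition is purely algebraic. *)
Definition partial_isometry n (W : 'M[C]_n) :=
  (W^t* *m W) *m (W^t* *m W) = W^t* *m W.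

(* Test the block matrix on the rows of [W, -1], then discard the projection
   [1 - W^* W]. *)
Lemma psd2_partial_isometry n (P X Q W : 'M[C]_n) :
  partial_isometry W -> psd2 P X Q ->
  \tr (W *m X) + conjC (\tr (W *m X)) <= \tr P + \tr Q.
Proof.
move=> hW h; rewrite -subr_ge0.
have := psd2_mxtrace (W^t*) (- 1%:M) h.
rewrite trmxCK adjmxN adjmx1 !(mulmxN, mulNmx, mulmx1, mul1mx, opprK) !linearN /=.
rewrite -adjmxM mxtrace_adj => h1.
set E := 1%:M - W^t* *m W.
have EE : E *m E^t* = E.
  rewrite /E adjmxD adjmxN adjmx1 adjmxM trmxCK mulmxBl mul1mx mulmxBr mulmx1 hW.
  by rewrite subrr subr0.
have := psd2_mxtrace E 0 h.
rewrite (_ : \tr (E^t* *m P *m E) = \tr P - \tr (W *m P *m W^t*)); last first.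
  rewrite mxtrace_mulC mulmxA EE /E mulmxBl mul1mx linearB /=; congr (_ - _).
  by rewrite [RHS]mxtrace_mulC mulmxA.
rewrite trmx0 map_mx0 !(mulmx0, mul0mx) mxtrace0 !addr0 => h2.
by have := addr_ge0 h1 h2; congr (0 <= _); ring.
Qed.

End PositiveBlocks.

(** * The trace norm *)

Section TraceNorm.
Variable R : realType.
Implicit Types D k : nat.
Local Notation C := R[i].

(* With [|X| = sqrt (X^* X)] and its pseudo-inverse [|X|^+] (entrywise inverse of
   the eigenvalues, where [0^-1 = 0]): [W = |X|^+ X^*], [S = X (|X|^+)^(1/2)] and
   [T = |X|^(1/2)]. *)
Lemma trnorm_polar D (X : 'M[C]_D) : exists W S T : 'M[C]_D,
  [/\ partial_isometry W, \tr (W *m X) = (trnorm X)%:C%C, X = S *m T^t*,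
      \tr (S *m S^t*) = (trnorm X)%:C%C & \tr (T *m T^t*) = (trnorm X)%:C%C].
Proof.
set G := X^t* *m X; set U := spectralmx G; set s := spectral_diag G.
have Uu : U \is unitarymx := spectral_unitarymx G.
have UU : U *m U^t* = 1%:M by apply/unitarymxP.
have UU' : U^t* *m U = 1%:M by exact: mulmx1C.
have Gn : G \is normalmx.
  by apply/normalmxP; rewrite /G adjmxM trmxCK.
pose Y := X *m U^t*.
have XE : X = Y *m U by rewrite /Y -mulmxA UU' mulmx1.
have YY : Y^t* *m Y = diag_mx s.
  rewrite /Y adjmxM trmxCK mulmxA -[U *m _ *m _]mulmxA -/G.
  move/orthomx_spectralP: Gn; rewrite -/U -/s invmx_unitary // => ->.
  by rewrite !mulmxA UU mul1mx -mulmxA UU mulmx1.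
move: Y XE YY => Y XE YY.
have sE i : s 0 i = \sum_k `|Y k i| ^+ 2.
  move/matrixP/(_ i i): YY; rewrite !mxE eqxx mulr1n => <-.
  by apply: eq_bigr => k _; rewrite !mxE normCK mulrC.
have s0 i : 0 <= s 0 i by rewrite sE; apply: sumr_ge0 => k _; exact: exprn_ge0.
pose d i := sqrtC (s 0 i); pose r i := sqrtC (d i).
have d0 i : 0 <= d i by rewrite sqrtC_ge0.
have r0 i : 0 <= r i by rewrite sqrtC_ge0.
have rr i : r i * r i = d i by rewrite -expr2 sqrtCK.
have dd i : d i * d i = s 0 i by rewrite -expr2 sqrtCK.
have conj0 (x : C) : 0 <= x -> conjC x = x by move=> /ger0_real /CrealP.
have trE : (trnorm X)%:C%C = \sum_i d i.
  rewrite /trnorm /sqrtmx -/G -/U -/s -mulmxA mxtrace_mulC mulmxK; last first.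
    exact: unitarymx_unit.
  rewrite mxtrace_diag RRe_real; last first.
    by apply: ger0_real; apply: sumr_ge0 => i _; rewrite mxE; exact: d0.
  by apply: eq_bigr => i _; rewrite mxE.
pose di : 'rV[C]_D := \row_i (d i)^-1.
pose ri : 'rV[C]_D := \row_i (r i)^-1.
pose rv : 'rV[C]_D := \row_i r i.
have diE : map_mx conjC di = di.
  by apply/rowP => i; rewrite !mxE conj0 // invr_ge0.
have riE : map_mx conjC ri = ri.
  by apply/rowP => i; rewrite !mxE conj0 // invr_ge0.
have rvE : map_mx conjC rv = rv.
  by apply/rowP => i; rewrite !mxE conj0.
exists (U^t* *m diag_mx di *m Y^t*), (Y *m diag_mx ri), (U^t* *m diag_mx rv).
split.
- rewrite /partial_isometry.
  set W := _ *m Y^t*.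
  have -> : W^t* *m W = Y *m diag_mx (\row_i (di 0 i * di 0 i)) *m Y^t*.
    rewrite /W !adjmxM !trmxCK adjmx_diag diE !mulmxA -(mulmxA _ U (U^t*)) UU.
    by rewrite mulmx1 -(mulmxA Y (diag_mx di)) mul_diag_mx2.
  rewrite !mulmxA -(mulmxA _ (Y^t*) Y) YY -(mulmxA Y _ (diag_mx s)) mul_diag_mx2
    -(mulmxA Y (diag_mx _) (diag_mx _)) mul_diag_mx2.
  congr (_ *m _); congr (_ *m _); congr diag_mx; apply/rowP=> i; rewrite !mxE -dd.
  have [->|dn0] := eqVneq (d i) 0; first by rewrite invr0 !(mul0r, mulr0).
  by field.
- rewrite [X in _ *m X]XE -!mulmxA mxtrace_mulC -!mulmxA UU mulmx1 YY mul_diag_mx2.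
  rewrite mxtrace_diag trE; apply: eq_bigr => i _; rewrite !mxE -dd.
  have [->|dn0] := eqVneq (d i) 0; first by rewrite invr0 !(mul0r, mulr0).
  by field.
- rewrite adjmxM trmxCK adjmx_diag rvE {1}XE mulmxA; congr (_ *m U).
  rewrite -mulmxA mul_diag_mx2; apply/matrixP=> k i.
  rewrite mul_mx_diag !mxE.
  (* Where the eigenvalue vanishes, so does column [i] of [Y], whose squared norm is [s 0 i]; the
     pseudo-inverse therefore loses nothing. *)
  have [ri0|rn0] := eqVneq (r i) 0; last by rewrite mulVf // mulr1.
  have : s 0 i = 0 by rewrite -dd -rr ri0 !mulr0.
  rewrite sE => /eqP; rewrite psumr_eq0; last first.
    by move=> j _; exact: exprn_ge0.
  move=> /allP /(_ k (mem_index_enum _)); rewrite sqrf_eq0 normr_eq0 => /eqP ->.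
  by rewrite mul0r.
- rewrite mxtrace_mulC adjmxM adjmx_diag riE mulmxA -(mulmxA _ (Y^t*)) YY.
  rewrite !mul_diag_mx2 mxtrace_diag trE; apply: eq_bigr => i _.
  rewrite !mxE -dd -rr.
  have [->|dn0] := eqVneq (r i) 0; first by rewrite invr0 !(mul0r, mulr0).
  by field.
- rewrite mxtrace_mulC adjmxM trmxCK adjmx_diag rvE mulmxA -(mulmxA _ U) UU.
  rewrite mulmx1 !mul_diag_mx2 mxtrace_diag trE; apply: eq_bigr => i _.
  by rewrite !mxE.
Qed.

(** One half of the minimum formula; the factorisation of [trnorm_polar] is the other half, since it
    attains the bound. The order of [R[i]] makes reality of [\tr P + \tr Q] part of the
    hypothesis. *)
Lemma trnorm_psd2 D (P X Q : 'M[C]_D) (r : R) :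
  psd2 P X Q -> \tr P + \tr Q <= (r *+ 2)%:C%C -> trnorm X <= r.
Proof.
move=> h hr; have [W [_ [_ [hW WX _ _ _]]]] := trnorm_polar X.
have := le_trans (psd2_partial_isometry hW h) hr.
rewrite WX (CrealP _); last by apply/complex_realP; exists (trnorm X).
by rewrite -mulr2n -rmorphMn lecR lerMn2r.
Qed.

Lemma trnorm_mul_adj D k (S T : 'M[C]_(D, k)) (r : R) :
  \tr (S *m S^t*) + \tr (T *m T^t*) <= (r *+ 2)%:C%C ->
  trnorm (S *m T^t*) <= r.
Proof. exact/trnorm_psd2/psd2_mul_adj. Qed.

Lemma trnorm_ge0 D (X : 'M[C]_D) : 0 <= trnorm X.
Proof.
have [_ [S [_ [_ _ _ SS _]]]] := trnorm_polar X.
by rewrite -lecR -SS; exact: mxtrace_mul_adj_ge0.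
Qed.

Lemma trnorm_partial_isometry D (W X : 'M[C]_D) :
  partial_isometry W -> complex.Re (\tr (W *m X)) <= trnorm X.
Proof.
move=> hW; have [_ [S [T [_ _ XE SS TT]]]] := trnorm_polar X.
have := psd2_partial_isometry hW (psd2_mul_adj S T).
rewrite -XE SS TT lecE => /andP[_].
rewrite -rmorphD /= !raddfD /= -[X in _ + X <= _]/(complex.Re (\tr (W *m X))^*%C).
by case: (\tr (W *m X)) => a b /=; lra.
Qed.

(** A single [W] that attains the trace norm of [X + Y] is tested on both summands. *)
Lemma trnormD D (X Y : 'M[C]_D) : trnorm (X + Y) <= trnorm X + trnorm Y.
Proof.
have [W [_ [_ [hW WX _ _ _]]]] := trnorm_polar (X + Y).
rewrite -[trnorm (X + Y)]/(complex.Re (trnorm (X + Y))%:C%C) -WX mulmxDr.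
by rewrite linearD raddfD lerD // trnorm_partial_isometry.
Qed.

Lemma trnorm_dual D (X : 'M[C]_D) : exists W : 'M[C]_D,
  complex.Re (\tr (W *m X)) = trnorm X /\
  forall Y, complex.Re (\tr (W *m Y)) <= trnorm Y.
Proof.
have [W [_ [_ [hW WX _ _ _]]]] := trnorm_polar X.
by exists W; rewrite WX; split=> // Y; exact: trnorm_partial_isometry.
Qed.

(** The test operator is a matrix unit times the phase that turns [X i j] into its modulus.
    Entrywise bounds of this kind feed the integrals and the exponential series. *)
Lemma le_trnorm_entry D (X : 'M[C]_D) i j : `|X i j| <= (trnorm X)%:C%C.
Proof.
have [->|x0] := eqVneq (X i j) 0; first by rewrite normr0 ler0c trnorm_ge0.
have nx0 : `|X i j| != 0 by rewrite normr_eq0.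
pose u := conjC (X i j) / `|X i j|.
have uu : conjC u * u = 1.
  rewrite mulrC -normCK /u normf_div norm_conjC normr_id divff // expr1n //.
have ux : u * X i j = `|X i j|.
  by rewrite /u mulrAC [_ * X i j]mulrC -normCK expr2 mulfK.
have hW : partial_isometry (u *: delta_mx j i : 'M[C]_D).
  rewrite /partial_isometry.
  suff -> : (u *: delta_mx j i : 'M[C]_D)^t* *m (u *: delta_mx j i) = delta_mx i i.
    by rewrite mul_delta_mx.
  rewrite adjmxZ -!scalemxAl -!scalemxAr !scalerA uu !scale1r.
  have -> : (delta_mx j i : 'M[C]_D)^t* = delta_mx i j.
    by apply/matrixP=> a b; rewrite !mxE andbC rmorph_nat.
  by rewrite mul_delta_mx.
have := trnorm_partial_isometry X hW.
rewrite -scalemxAl linearZ /= -(mul_delta_mx (0 : 'I_1)) -mulmxA mxtrace_mulC.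
rewrite -rowE -colE trace_mx11 !mxE ux => h.
by rewrite -(@RRe_real _ `|X i j|) ?normr_real // lecR.
Qed.

Lemma trnorm_eq0 D (X : 'M[C]_D) : trnorm X = 0 -> X = 0.
Proof.
move=> X0; apply/matrixP=> i j; rewrite mxE; apply/eqP.
by rewrite -normr_le0; have := le_trnorm_entry X i j; rewrite X0.
Qed.

(** Scaling [S] by [c / sqrt |c|] and [T] by [sqrt |c|] multiplies both traces by [|c|]; this needs
    [c] nonzero. The real bound [r] avoids turning the complex-valued [|c|] into an element of
    [R]. *)
Lemma trnormZ_le D (c : C) (r : R) (X : 'M[C]_D) :
  `|c| <= r%:C%C -> trnorm (c *: X) <= r * trnorm X.
Proof.
move=> cr.
have [c0|c0] := eqVneq c 0.
  rewrite c0 normr0 ler0c in cr.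
  have := @trnorm_mul_adj D D 0 0 0.
  rewrite mul0mx mxtrace0 addr0 mul0rn c0 scale0r => /(_ (lexx _)) h.
  exact: le_trans h (mulr_ge0 cr (trnorm_ge0 _)).
have [_ [S [T [_ _ XE SS TT]]]] := trnorm_polar X.
pose q := sqrtC `|c|.
have q0 : 0 < q by rewrite sqrtC_gt0 normr_gt0.
have qn0 : q != 0 by rewrite gt_eqF.
have qq : q * q = `|c| by rewrite -expr2 sqrtCK.
have -> : c *: X = ((c / q) *: S) *m (q *: T)^t*.
  rewrite {1}XE adjmxZ -scalemxAl -scalemxAr scalerA.
  by rewrite (CrealP (gtr0_real q0)) mulfVK.
apply: trnorm_mul_adj.
rewrite !adjmxZ -!scalemxAl -!scalemxAr !scalerA !linearZ /= SS TT -!normCK.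
rewrite normf_div (gtr0_norm q0) expr_div_n !expr2 qq mulfK ?normr_eq0 //.
rewrite -mulrDr -rmorphD /= -mulr2n -mulrnAr rmorphM /=.
by rewrite ler_wpM2r // ler0c mulrn_wge0 // trnorm_ge0.
Qed.

(** Both Kraus terms share one factorisation, with [[A S, B S]] in place of [S]. Separate bounds
    would add up and miss any cancellation between [A^* A] and [B^* B]. *)
Lemma trnorm_kraus2 D (A B X : 'M[C]_D) (c : R) :
  (forall v : 'cV[C]_D,
    ((A *m v)^t* *m (A *m v)) 0 0 + ((B *m v)^t* *m (B *m v)) 0 0
    <= c%:C%C * (v^t* *m v) 0 0) ->
  trnorm (A *m X *m A^t* + B *m X *m B^t*) <= c * trnorm X.
Proof.
move=> h.
have hS k (S : 'M[C]_(D, k)) :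
    \tr ((row_mx (A *m S) (B *m S)) *m (row_mx (A *m S) (B *m S))^t*)
    <= c%:C%C * \tr (S *m S^t*).
  have trE m (Z : 'M[C]_(D, m)) :
      \tr (Z *m Z^t*) = \sum_k ((col k Z)^t* *m col k Z) 0 0.
    rewrite mxtrace_mulC -{1}[Z^t*]mulmx1 mxtrace_col.
    by apply: eq_bigr => i _; rewrite mulmx1.
  rewrite tr_row_mx map_col_mx mul_row_col linearD /= !trE -big_split /=.
  rewrite mulr_sumr; apply: ler_sum => i _.
  have colM (Z : 'M[C]_D) : col i (Z *m S) = Z *m col i S.
    by apply/matrixP=> a b; rewrite !mxE; apply: eq_bigr => l _; rewrite !mxE.
  by rewrite !colM; exact: h.
have [_ [S [T [_ _ XE SS TT]]]] := trnorm_polar X.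
have -> : A *m X *m A^t* + B *m X *m B^t* =
   row_mx (A *m S) (B *m S) *m (row_mx (A *m T) (B *m T))^t*.
  by rewrite tr_row_mx map_col_mx mul_row_col !adjmxM !mulmxA {1 2}XE !mulmxA.
apply: trnorm_mul_adj; apply: le_trans (lerD (hS _ S) (hS _ T)) _.
by rewrite SS TT -!rmorphM -rmorphD /= lecR mulr2n.
Qed.

End TraceNorm.

(** * Euler products and exponentials in a seminormed space *)

Section RealExp.
Variable R : realType.
Implicit Types x : R.

Lemma expR_ge_partial x n : 0 <= x -> \sum_(k < n) x ^+ k / k`!%:R <= expR x.
Proof.
move=> x0; have -> : \sum_(k < n) x ^+ k / k`!%:R = series (exp_coeff x) n.
  by rewrite /series /= big_mkord.
apply: nondecreasing_cvgn_le; last exact: is_cvg_series_exp_coeff.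
by apply: nondecreasing_series => k _ _; exact: exp_coeff_ge0.
Qed.

Lemma expR_le_mul1 x : 0 <= x -> expR x - 1 <= x * expR x.
Proof.
move=> x0; have := expR_ge1Dx (- x); rewrite expRN => h.
have e0 := expR_gt0 x.
have : (1 + - x) * expR x <= (expR x)^-1 * expR x by rewrite ler_pM2r.
by rewrite mulVf ?gt_eqF //; nra.
Qed.

Lemma expR_remainder2 x : 0 <= x -> expR x - 1 - x <= x ^+ 2 * expR x.
Proof.
by move=> x0; have := expR_le_mul1 x0; have := expR_gt0 x; nra.
Qed.

Lemma expr1D_le_expR x n : 0 <= x -> (1 + x) ^+ n <= expR (x * n%:R).
Proof.
move=> x0; rewrite expRM_natr; apply: lerXn2r; rewrite ?nnegrE ?expR_ge0 //.
  by rewrite addr_ge0.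
exact: expR_ge1Dx.
Qed.

Lemma expr1N_ge x n : 0 <= x <= 1 -> 1 - n%:R * x <= (1 - x) ^+ n.
Proof.
move=> /andP[x0 x1]; elim: n => [|n IH]; first by rewrite mul0r subr0 expr0.
rewrite exprS -natr1.
have : (1 - x) * (1 - n%:R * x) <= (1 - x) * (1 - x) ^+ n.
  by rewrite ler_wpM2l // subr_ge0.
have : 0 <= n%:R * x ^+ 2 by rewrite mulr_ge0 // exprn_ge0.
by nra.
Qed.

(** With [y = x / K], the inequality [exp (- y) >= 1 - y] gives
    [(1 + y)^K exp (- x) >= (1 - y^2)^K], which is at least [1 - K y^2] by Bernoulli. If [y > 1],
    then [K y^2 >= 1] and the right side is already at least [expR x]. *)
Lemma expR_euler_le x K : 0 <= x -> (0 < K)%N ->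
  expR x - (1 + x / K%:R) ^+ K <= expR x * x ^+ 2 / K%:R.
Proof.
move=> x0 K0.
have Kp : 0 < K%:R :> R by rewrite ltr0n.
have e0 := expR_gt0 x.
have pw0 : 0 <= (1 + x / K%:R) ^+ K by rewrite exprn_ge0 // addr_ge0 // divr_ge0.
pose y := x / K%:R.
have y0 : 0 <= y by rewrite divr_ge0.
have xE : x = y * K%:R by rewrite /y mulfVK // gt_eqF.
have e2 : expR x * x ^+ 2 / K%:R = expR x * (K%:R * y ^+ 2).
  by rewrite -mulrA /y; congr (_ * _); field; rewrite gt_eqF.
rewrite e2 -/y.
have [y1|y1] := leP y 1; last first.
  have : 1 <= K%:R * y ^+ 2.
    have : 1 <= K%:R :> R by rewrite ler1n.
    by nra.
  by rewrite -/y in pw0; nra.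
have h1 : 1 - K%:R * y ^+ 2 <= (1 - y ^+ 2) ^+ K.
  by apply: expr1N_ge; rewrite sqr_ge0 /= expr_le1.
have h2 : (1 - y ^+ 2) ^+ K <= (1 + y) ^+ K * expR (- x).
  have -> : expR (- x) = expR (- y) ^+ K by rewrite -expRM_natr xE mulNr.
  rewrite -exprMn; apply: lerXn2r.
  - by rewrite nnegrE subr_ge0 expr_le1.
  - by rewrite nnegrE mulr_ge0 ?expR_ge0 ?addr_ge0.
  - by have := expR_ge1Dx (- y); nra.
have := le_trans h1 h2; rewrite expRN -(ler_pM2r e0) mulfVK ?gt_eqF //; lra.
Qed.

End RealExp.

Section SeminormEstimates.
Variables (R : realType) (V : lmodType R[i]) (p : V -> R).
Hypothesis p_ge0 : forall x, 0 <= p x.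
Hypothesis pD : forall x y, p (x + y) <= p x + p y.
Hypothesis pZ : forall c r x, `|c| <= r%:C%C -> p (c *: x) <= r * p x.

Definition bounded_by (f : V -> V) (b : R) := forall x, p (f x) <= b * p x.

(** Truncated, since [V] carries no topology here; the limit is taken entrywise later. *)
Definition exp_partial (f : V -> V) n x :=
  \sum_(k < n) (k`!%:R^-1 : R[i]) *: iter k f x.

Lemma norm_real_le (s : R) : 0 <= s -> `|s%:C%C| <= s%:C%C.
Proof. by move=> s0; rewrite ger0_norm // ler0c. Qed.

Lemma seminorm_sum n (F : 'I_n -> V) : p (\sum_i F i) <= \sum_i p (F i).
Proof.
elim/big_ind2: _ => //.
  by have := @pZ 0 0 0; rewrite scale0r mul0r normr0 lexx; exact.
by move=> x1 x2 y1 y2 h1 h2; apply: le_trans (pD _ _) (lerD h1 h2).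
Qed.

Lemma bounded_by_iter f b k : 0 <= b -> bounded_by f b ->
  bounded_by (iter k f) (b ^+ k).
Proof.
move=> b0 h; elim: k => [|k IH] x /=; first by rewrite expr0 mul1r.
by apply: le_trans (h _) _; rewrite exprS -mulrA ler_wpM2l.
Qed.

Lemma telescope_bound (F B : V -> V) (beta delta : R) M :
  zmod_morphism F -> bounded_by F 1 -> 1 <= beta -> bounded_by B beta ->
  0 <= delta -> bounded_by (fun x => F x - B x) delta ->
  bounded_by (fun x => iter M F x - iter M B x) (M%:R * delta * beta ^+ M).
Proof.
move=> Fa F1 b1 Bb d0 FB; have b0 : 0 <= beta by exact: le_trans b1.
elim: M => [|M IH] x.
  rewrite /= subrr !mul0r; have := @pZ 0 0 0.
  by rewrite scale0r mul0r normr0 lexx; exact.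
have -> : iter M.+1 F x - iter M.+1 B x =
    F (iter M F x - iter M B x) + (F (iter M B x) - B (iter M B x)).
  by rewrite /= Fa addrA subrK.
apply: le_trans (pD _ _) _.
have h1 := le_trans (F1 (iter M F x - iter M B x)) (ler_wpM2l ler01 (IH x)).
have h2 := le_trans (FB (iter M B x))
  (ler_wpM2l d0 (bounded_by_iter M b0 Bb x)).
apply: le_trans (lerD h1 h2) _.
have -> : 1 * (M%:R * delta * beta ^+ M * p x) + delta * (beta ^+ M * p x) =
    M.+1%:R * delta * beta ^+ M * p x by rewrite -natr1; ring.
by rewrite ler_wpM2r // ler_wpM2l ?ler_weXn2l // mulr_ge0.
Qed.

Definition euler (f : {linear V -> V}) (s : R) x := x + s%:C%C *: f x.

(** Majorant argument: the remainder satisfies [e' = e + s^2 m f (f x) + s f e], and the scalar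
    factor on the right satisfies the same recursion with [b] for [f]. *)
Lemma euler_iter_remainder (f : {linear V -> V}) (s b : R) m x :
  0 <= s -> 0 <= b -> bounded_by f b ->
  p (iter m (euler f s) x - x - (s * m%:R)%:C%C *: f x) <=
  ((1 + s * b) ^+ m - 1 - s * m%:R * b) * p x.
Proof.
move=> s0 b0 fb; elim: m => [|m IH].
  rewrite /= subrr mulr0 scale0r subrr expr0 subrr mul0r subrr.
  by have := @pZ 0 0 0; rewrite scale0r !mul0r normr0 lexx; exact.
set e := iter m _ _ - _ - _ in IH; set E := _ - _ - _ in IH.
have -> : iter m.+1 (euler f s) x - x - (s * m.+1%:R)%:C%C *: f x =
    e + (s * (s * m%:R))%:C%C *: f (f x) + s%:C%C *: f e.
  have ie : iter m (euler f s) x = e + x + (s * m%:R)%:C%C *: f x.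
    by rewrite /e addrAC !subrK.
  have -> : iter m.+1 (euler f s) x = e + x + (s * m%:R)%:C%C *: f x +
      (s%:C%C *: f e + s%:C%C *: f x + (s * (s * m%:R))%:C%C *: f (f x)).
    rewrite iterS /euler ie (linearD f) (linearD f) (linearZ_LR f) /=.
    by rewrite !scalerDr scalerA -rmorphM.
  rewrite -natr1 mulrDr mulr1 rmorphD scalerDl /=.
  set a1 := s%:C%C *: f x; set a2 := _ *: f x; set a3 := _ *: f (f x).
  set a4 := _ *: f e.
  have zmod_id (Z : zmodType) (z e' a c d t : Z) :
      e' + z + t + (d + a + c) - z - (t + a) = e' + c + d.
    rewrite [e' + z]addrC -(addrA z e') -(addrA z) [z + _]addrC addrK.
    by rewrite [d + a + c]addrAC addrACA addrK [d + c]addrC addrA.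
  exact: zmod_id.
have EE : (1 + s * b) ^+ m.+1 - 1 - s * m.+1%:R * b =
    E + s * (s * m%:R) * (b * b) + s * (b * E).
  by rewrite /E exprS -natr1; ring.
rewrite EE; apply: le_trans (pD _ _) _; rewrite mulrDl; apply: lerD.
  apply: le_trans (pD _ _) _; rewrite mulrDl; apply: lerD => //.
  rewrite -mulrA; apply: le_trans (pZ _ (norm_real_le _)) _; first exact/mulr_ge0/mulr_ge0.
  rewrite ler_wpM2l ?mulr_ge0 // -mulrA.
  by apply: le_trans (fb _) _; rewrite ler_wpM2l.
apply: le_trans (pZ _ (norm_real_le s0)) _; rewrite -mulrA ler_wpM2l // -mulrA.
by apply: le_trans (fb _) _; rewrite ler_wpM2l.
Qed.

Lemma euler_iterE (f : {linear V -> V}) (s : R) K x :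
  iter K (euler f s) x = \sum_(k < K.+1) (s ^+ k *+ 'C(K, k))%:C%C *: iter k f x.
Proof.
elim: K => [|K IH]; first by rewrite big_ord1 expr0 scale1r.
rewrite iterS IH /euler linear_sum scaler_sumr /=.
rewrite [RHS]big_ord_recl /= expr0 bin0 scale1r.
rewrite [in RHS]big_ord_recr /= binn mulr1n.
rewrite big_ord_recl /= expr0 bin0 scale1r -addrA; congr (_ + _).
rewrite [X in _ + X]big_ord_recr /= addrA binn mulr1n linearZ /= scalerA.
rewrite -rmorphM -exprS; congr (_ + _).
rewrite -big_split /=; apply: eq_bigr => i _.
rewrite /bump /= add1n binS mulrnDr rmorphD scalerDl; congr (_ + _).
by rewrite linearZ /= scalerA -rmorphM mulrnAr -exprS.
Qed.

(* All coefficients [1/k! - 'C(K, k)/K^k] are nonnegative, so the scalar estimate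
   at [b] bounds the difference. *)
Lemma exp_partial_euler (f : {linear V -> V}) (b : R) K n x :
  0 <= b -> bounded_by f b ->
  (0 < K < n)%N ->
  p (exp_partial f n x - iter K (euler f K%:R^-1) x) <=
  expR b * b ^+ 2 / K%:R * p x.
Proof.
move=> b0 fb /andP[K0 Kn].
have Kp : 0 < K%:R :> R by rewrite ltr0n.
pose c k : R := k`!%:R^-1 - K%:R^-1 ^+ k *+ 'C(K, k).
(* [k! 'C(K, k)] is a falling factorial, a product of [k] factors that are at most [K]. *)
have c0 k : 0 <= c k.
  rewrite /c subr_ge0 -(ler_pM2r (_ : 0 < k`!%:R)) ?ltr0n ?fact_gt0 //.
  rewrite mulVf ?pnatr_eq0 -?lt0n ?fact_gt0 // -mulr_natr -mulrA.
  rewrite -natrM bin_ffact exprVn ler_pdivrMl ?exprn_gt0 // mulr1 -natrX ler_nat.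
  elim: k => [|k IH]; first by rewrite ffactn0 expn0.
  by rewrite ffactnSr expnSr leq_mul // leq_subr.
(* As [K < n], the binomial sum can be padded to [n] terms: the added coefficients are zero. *)
have euE : iter K (euler f K%:R^-1) x =
    \sum_(k < n) (K%:R^-1 ^+ k *+ 'C(K, k))%:C%C *: iter k f x.
  rewrite euler_iterE -[RHS](big_mkord xpredT
    (fun k => (K%:R^-1 ^+ k *+ 'C(K, k))%:C%C *: iter k f x)).
  rewrite (big_cat_nat _ Kn) //= big_mkord.
  rewrite [X in _ = _ + X]big_nat [X in _ = _ + X]big1 ?addr0 //.
  by move=> i /andP[Ki _]; rewrite bin_small // mulr0n scale0r.
have -> : exp_partial f n x - iter K (euler f K%:R^-1) x =
    \sum_(k < n) (c k)%:C%C *: iter k f x.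
  rewrite euE -sumrB; apply: eq_bigr => i _.
  by rewrite -scalerBl /c rmorphB /= fmorphV rmorph_nat.
apply: le_trans (seminorm_sum _) _.
apply: (@le_trans _ _ ((\sum_(k < n) c k * b ^+ k) * p x)).
  rewrite mulr_suml; apply: ler_sum => i _.
  apply: le_trans (pZ _ (norm_real_le (c0 _))) _; rewrite -mulrA ler_wpM2l //.
  exact: bounded_by_iter.
rewrite ler_wpM2r //; apply: le_trans _ (expR_euler_le b0 K0).
rewrite (eq_bigr (fun k : 'I_n => b ^+ k / k`!%:R -
  (b / K%:R) ^+ k *+ 'C(K, k))); last first.
  move=> i _; rewrite /c mulrBl exprMn mulrnAl; congr (_ - _ *+ _); exact: mulrC.
rewrite sumrB lerB //; first exact: expR_ge_partial.
rewrite exprDn -[X in _ <= X](big_mkord xpredT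
  (fun k => (b / K%:R) ^+ k *+ 'C(K, k))).
rewrite (big_cat_nat _ Kn) //= big_mkord.
rewrite [X in _ <= _ + X]big_nat [X in _ <= _ + X]big1 ?addr0; last first.
  by move=> i /andP[Ki _]; rewrite bin_small // mulr0n.
by apply: ler_sum => i _; rewrite expr1n mul1r.
Qed.

Lemma seminormN_le x : p (- x) <= p x.
Proof. by have := @pZ (-1) 1 x; rewrite scaleN1r mul1r normrN1 lexx; exact. Qed.

(** The step length is absorbed into [f], so [exp f] is one step and [exp (M f)] the target. The
    slack [eps] pays for replacing [exp (M f)] by a finite Euler product. *)
Lemma chernoff_bound (f : {linear V -> V}) (F : V -> V) (b c delta eps : R) M :
  zmod_morphism F -> bounded_by F 1 ->
  0 <= delta -> bounded_by (fun x => F x - x - f x) delta ->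
  0 <= b -> bounded_by f b ->
  0 <= c -> (forall s, 0 <= s -> bounded_by (euler f s) (1 + c * s ^+ 2)) ->
  (0 < M)%N -> 0 < eps ->
  exists n0, forall n, (n0 <= n)%N -> bounded_by
    (fun x => iter M F x - exp_partial ((M%:R : R[i]) \*: f)%R n x)
    (M%:R * (delta + b ^+ 2 * expR b) * expR 1 + eps).
Proof.
move=> Fa F1 d0 Fd b0 fb c0 fc M0 e0.
have Mp : 0 < M%:R :> R by rewrite ltr0n.
pose y := M%:R * b; have y0 : 0 <= y by exact: mulr_ge0.
pose q := expR y * y ^+ 2 / eps.
have q0 : 0 <= q by rewrite /q !mulr_ge0 ?expR_ge0 // invr_ge0 ltW.
have cM0 : 0 <= c * M%:R by rewrite mulr_ge0.
(* [m > c M] keeps the [M]-th power of the bound on [B] below [expR 1]; [m > q] brings the distance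
   between the Euler product and the exponential below [eps]. *)
pose m := (Num.bound (c * M%:R + q)).+1.
have hm : c * M%:R + q < m%:R.
  apply: lt_le_trans (archi_boundP (addr_ge0 cM0 q0)) _.
  by rewrite ler_nat /m leqnSn.
have m0 : 0 < m%:R :> R by rewrite ltr0n.
pose B := iter m (euler f m%:R^-1).
have B1 : bounded_by B ((1 + c * m%:R^-1 ^+ 2) ^+ m).
  apply: bounded_by_iter; last by apply: fc; rewrite invr_ge0.
  by rewrite addr_ge0 // mulr_ge0 // sqr_ge0.
have cm0 : 0 <= c * m%:R^-1 ^+ 2 by rewrite mulr_ge0 // sqr_ge0.
have FB : bounded_by (fun x => F x - B x) (delta + b ^+ 2 * expR b).
  move=> x.
  have -> : F x - B x = (F x - x - f x) + - (B x - x - f x).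
    have zmod_id (Z : zmodType) (u v w z : Z) : u - v = u - w - z + - (v - w - z).
      by rewrite -[u - w - z]addrA -[v - w - z]addrA -!opprD opprB addrA subrK.
    exact: zmod_id.
  apply: le_trans (pD _ _) _; rewrite mulrDl; apply: lerD; first exact: Fd.
  apply: le_trans (seminormN_le _) _.
  have mi0 : 0 <= m%:R^-1 :> R by rewrite invr_ge0.
  have := euler_iter_remainder m x mi0 b0 fb.
  rewrite mulVf ?gt_eqF // scale1r mul1r => h; apply: le_trans h _.
  rewrite ler_wpM2r //; apply: le_trans _ (expR_remainder2 b0).
  rewrite !lerB // -[X in _ <= expR X](mulfVK (lt0r_neq0 m0)) mulrC.
  apply: expr1D_le_expR; exact: mulr_ge0.
have beta1 : 1 <= (1 + c * m%:R^-1 ^+ 2) ^+ m by rewrite exprn_ege1 // lerDl.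
have dd0 : 0 <= delta + b ^+ 2 * expR b.
  by rewrite addr_ge0 // mulr_ge0 ?expR_ge0 // sqr_ge0.
have tel := telescope_bound M Fa F1 beta1 B1 dd0 FB.
have betaM : ((1 + c * m%:R^-1 ^+ 2) ^+ m) ^+ M <= expR 1.
  rewrite -exprM; apply: le_trans (expr1D_le_expR _ cm0) _.
  rewrite ler_expR natrM.
  have -> : c * m%:R^-1 ^+ 2 * (m%:R * M%:R) = c * M%:R / m%:R.
    by field; rewrite gt_eqF.
  by rewrite ler_pdivrMr // mul1r; apply: le_trans (ltW hm); rewrite lerDl.
(* [exp (M f)] is compared with [(1 + f / m)^(m M)]. *)
exists (m * M).+1 => n hn x.
have fMb : bounded_by ((M%:R : R[i]) \*: f)%R y.
  move=> z; rewrite /y -mulrA /=.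
  apply: le_trans (@pZ _ M%:R _ _) _; last by rewrite ler_wpM2l.
  by rewrite rmorph_nat normr_nat.
have mM : (0 < m * M < n)%N by rewrite muln_gt0 M0 hn.
have E2 := exp_partial_euler x y0 fMb mM.
have eulerE : iter (m * M) (euler (M%:R \*: f)%R (m * M)%:R^-1) x = iter M B x.
  rewrite mulnC iterM; apply: eq_iter => z; apply: eq_iter => w.
  rewrite /euler /= scalerA -(rmorph_nat (real_complex R)) -rmorphM /=.
  rewrite natrM invfM mulrAC mulVf ?mul1r //.
  by rewrite gt_eqF.
rewrite eulerE in E2.
have -> : iter M F x - exp_partial (M%:R \*: f)%R n x =
    (iter M F x - iter M B x) + - (exp_partial (M%:R \*: f)%R n x - iter M B x).
  by rewrite opprB addrA subrK.
apply: le_trans (pD _ _) _; rewrite mulrDl; apply: lerD.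
  apply: le_trans (tel x) _; apply: ler_wpM2r => //; apply: ler_wpM2l => //; exact: mulr_ge0.
apply: le_trans (seminormN_le _) _; apply: le_trans E2 _; rewrite ler_wpM2r //.
have mMp : 0 < (m * M)%:R :> R by rewrite ltr0n; case/andP: mM.
rewrite ler_pdivrMr // natrM.
have -> : expR y * y ^+ 2 = eps * q by rewrite /q [RHS]mulrC divfK // gt_eqF.
rewrite ler_pM2l //.
have : q <= m%:R by apply: le_trans (ltW hm); rewrite lerDr.
have : 1 <= M%:R :> R by rewrite ler1n.
by have := q0; nra.
Qed.

End SeminormEstimates.

(** * Ampliations and channels *)

Section Ampliation.
Variables (R : realType) (N : nat).
Local Notation C := R[i].
Implicit Types (Phi Psi : superop R N).

Lemma ampliationE k Phi X s t :
  ampliation (k := k) Phi X s t =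
  Phi (submxblock X (tagnat.sig1 s) (tagnat.sig1 t)) (tagnat.sig2 s) (tagnat.sig2 t).
Proof. by rewrite mxE. Qed.

Lemma ampliation_linear k Phi : linear Phi -> linear (@ampliation R N k Phi).
Proof.
move=> h a X Y; apply/matrixP=> s t; rewrite !(ampliationE, mxE).
have -> : submxblock (a *: X + Y) (tagnat.sig1 s) (tagnat.sig1 t) =
  a *: submxblock X (tagnat.sig1 s) (tagnat.sig1 t) +
  submxblock Y (tagnat.sig1 s) (tagnat.sig1 t) by apply/matrixP=> i j; rewrite !mxE.
by rewrite h !mxE.
Qed.

Lemma ampliationB k Phi Psi X :
  ampliation (k := k) (Phi \- Psi) X = ampliation Phi X - ampliation Psi X.
Proof. by apply/matrixP=> s t; rewrite !(ampliationE, mxE). Qed.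

Lemma ampliationZ k c Phi X :
  ampliation (k := k) (c \*: Phi) X = c *: ampliation Phi X.
Proof. by apply/matrixP=> s t; rewrite !(ampliationE, mxE). Qed.

Lemma ampliation_iter k Phi m X :
  ampliation (k := k) (iter m Phi) X = iter m (ampliation Phi) X.
Proof.
elim: m X => [|m IH] X /=; first by rewrite /ampliation submxblockK.
rewrite -IH /ampliation; apply/matrixP=> s t; rewrite !mxE.
by rewrite mxblockK.
Qed.

Lemma adj_mxcol k m (u : 'I_k -> 'M[C]_(N, m)) :
  (\mxcol_i u i)^t* = \mxrow_i (u i)^t*.
Proof. by rewrite tr_mxcol; apply/matrixP=> s t; rewrite !mxE. Qed.

Lemma sesq_mxblock k (B : 'I_k -> 'I_k -> 'M[C]_N) (u v : 'I_k -> 'cV[C]_N) :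
  ((\mxcol_i u i)^t* *m (\mxblock_(i, j) B i j) *m \mxcol_i v i) 0 0 =
  \sum_i \sum_j ((u i)^t* *m B i j *m v j) 0 0.
Proof.
rewrite adj_mxcol mul_mxrow_mxblock mul_mxrow_mxcol summxE exchange_big /=.
by apply: eq_bigr => j _; rewrite mulmx_suml summxE.
Qed.

Lemma addmxE m n (A B : 'M[C]_(m, n)) i j : (A + B) i j = A i j + B i j.
Proof. by rewrite mxE. Qed.

Lemma oppmxE m n (A : 'M[C]_(m, n)) i j : (- A) i j = - A i j.
Proof. by rewrite mxE. Qed.

Lemma scalemxE m n c (A : 'M[C]_(m, n)) i j : (c *: A) i j = c * A i j.
Proof. by rewrite mxE. Qed.

(* Reality of the form at [u] and at ['i *: u] forces [Y = X^*]. *)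
Lemma psd_psd2 n (P X Y Q : 'M[C]_n) :
  (forall u w : 'cV[C]_n, 0 <= (u^t* *m P *m u + u^t* *m X *m w
        + w^t* *m Y *m u + w^t* *m Q *m w) 0 0) ->
  psd2 P X Q.
Proof.
move=> h u w.
have conjE (A : 'M[C]_n) (v z : 'cV[C]_n) :
    conjC ((v^t* *m A *m z) 0 0) = (z^t* *m A^t* *m v) 0 0.
  have -> : z^t* *m A^t* *m v = (v^t* *m A *m z)^t*.
    by rewrite !adjmxM trmxCK mulmxA.
  by rewrite !mxE.
have P0 (v : 'cV[C]_n) : 0 <= (v^t* *m P *m v) 0 0.
  by have := h v 0; rewrite trmx0 map_mx0 !(mulmx0, mul0mx) !addr0.
have Q0 (v : 'cV[C]_n) : 0 <= (v^t* *m Q *m v) 0 0.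
  by have := h 0 v; rewrite trmx0 map_mx0 !(mulmx0, mul0mx) !add0r.
pose a (v : 'cV[C]_n) := (v^t* *m X *m w) 0 0.
pose b (v : 'cV[C]_n) := (w^t* *m Y *m v) 0 0.
have ab_real v : a v + b v \is Num.real.
  have -> : a v + b v = (v^t* *m P *m v + v^t* *m X *m w
        + w^t* *m Y *m v + w^t* *m Q *m w) 0 0 - (v^t* *m P *m v) 0 0
        - (w^t* *m Q *m w) 0 0 by rewrite !addmxE /a /b; ring.
  by rewrite !realB // ger0_real.
suff e : (w^t* *m Y *m u) 0 0 = (w^t* *m X^t* *m u) 0 0.
  by have h' := h u w; rewrite !addmxE in h'; rewrite !addmxE -e; exact: h'.
rewrite -conjE -/(a u) -/(b u).
have := ab_real u; have := ab_real ('i *: u).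
have -> : a ('i *: u) = - 'i * a u.
  by rewrite /a adjmxZ -!scalemxAl mxE conjCi.
have -> : b ('i *: u) = 'i * b u by rewrite /b -scalemxAr mxE.
case: (a u) (b u) => [ar ai] [br bi].
rewrite -complexiE => /complex_realP[k1 /(congr1 (@complex.Im _)) /= h1].
move=> /complex_realP[k2 /(congr1 (@complex.Im _)) /= h2].
apply/eqP; rewrite -[conjC _]/((ar +i* ai)^*)%C eq_complex /=; apply/andP.
by split; apply/eqP; lra.
Qed.

(** Encodes [[[P, X], [Y, Q]]] over [C^k] as one array over [C^(k + k)], so that complete positivity
    at level [k + k] applies to it. *)
Definition pair_block k (P X Y Q : 'I_k -> 'I_k -> 'M[C]_N) (i j : 'I_(k + k)) :=
  match fintype.split i, fintype.split j with
  | inl a, inl b => P a b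
  | inl a, inr b => X a b
  | inr a, inl b => Y a b
  | inr a, inr b => Q a b
  end.

Definition pair_vec k (u w : 'I_k -> 'cV[C]_N) (i : 'I_(k + k)) :=
  match fintype.split i with inl a => u a | inr a => w a end.

Lemma split_lshiftE k (i : 'I_k) : fintype.split (lshift k i) = inl i.
Proof. exact: (fintype.unsplitK (inl i)). Qed.

Lemma split_rshiftE k (i : 'I_k) : fintype.split (rshift k i) = inr i.
Proof. exact: (fintype.unsplitK (inr i)). Qed.

Lemma sesq_pair_block k (P X Y Q : 'I_k -> 'I_k -> 'M[C]_N)
    (u w : 'I_k -> 'cV[C]_N) (U := \mxcol_i u i) (W := \mxcol_i w i) :
  ((\mxcol_i pair_vec u w i)^t* *m (\mxblock_(i, j) pair_block P X Y Q i j) *m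
    \mxcol_i pair_vec u w i) 0 0 =
  (U^t* *m (\mxblock_(i, j) P i j) *m U + U^t* *m (\mxblock_(i, j) X i j) *m W
   + W^t* *m (\mxblock_(i, j) Y i j) *m U + W^t* *m (\mxblock_(i, j) Q i j) *m W) 0 0.
Proof.
rewrite !addmxE /U /W !sesq_mxblock big_split_ord /= -addrA.
congr (_ + _).
  rewrite -big_split; apply: eq_bigr => i _; rewrite big_split_ord /=.
  by congr (_ + _); apply: eq_bigr => j _;
    rewrite /pair_vec /pair_block !(split_lshiftE, split_rshiftE).
rewrite -big_split; apply: eq_bigr => i _; rewrite big_split_ord /=.
by congr (_ + _); apply: eq_bigr => j _;
  rewrite /pair_vec /pair_block !(split_lshiftE, split_rshiftE).
Qed.

(** The lower left block of the image is the ampliation of [Phi] at [X^*]. That it is the adjoint of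
    the upper right block follows from [psd_psd2], which spares a separate proof that [Phi] commutes
    with adjoints. *)
Lemma completely_positive_psd2 k Phi (P X Q : 'M[C]_(\sum_(_ < k) N)) :
  completely_positive Phi -> psd2 P X Q ->
  psd2 (ampliation Phi P) (ampliation Phi X) (ampliation Phi Q).
Proof.
move=> cp h.
apply: (@psd_psd2 _ _ _ (ampliation Phi (X^t*))) => u w.
pose B := pair_block (submxblock P) (submxblock X) (submxblock (X^t*)) (submxblock Q).
have Bpsd : psd (\mxblock_(i, j) B i j).
  move=> v; have -> : v = \mxcol_i pair_vec
      (fun i => submxcol v (lshift k i)) (fun i => submxcol v (rshift k i)) i.
    rewrite -[LHS]submxcolK; apply: eq_mxcol => i.
    rewrite /pair_vec; case: fintype.splitP => j ij; congr submxcol; exact: val_inj.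
  by rewrite sesq_pair_block !submxblockK.
have := cp _ _ Bpsd (\mxcol_i pair_vec (submxcol u) (submxcol w) i).
have -> : ampliation Phi (\mxblock_(i, j) B i j) = \mxblock_(i, j)
    pair_block (fun a b => Phi (submxblock P a b)) (fun a b => Phi (submxblock X a b))
     (fun a b => Phi (submxblock (X^t*) a b)) (fun a b => Phi (submxblock Q a b)) i j.
  apply: eq_mxblock => i j; rewrite mxblockK /B /pair_block.
  by case: (fintype.split i) => a; case: (fintype.split j).
by rewrite sesq_pair_block !submxcolK.
Qed.

Lemma trace_preserving_ampliation k Phi (X : 'M[C]_(\sum_(_ < k) N)) :
  trace_preserving Phi -> \tr (ampliation Phi X) = \tr X.
Proof.
move=> tp; rewrite -[X in RHS]submxblockK !mxtrace_mxblock.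
by apply: eq_bigr => i _; exact: tp.
Qed.

(** Complete positivity carries the optimal blocks [S S^*] and [T T^*] to admissible blocks for the
    image, and trace preservation keeps their traces. *)
Lemma trnorm_channel k Phi (X : 'M[C]_(\sum_(_ < k) N)) :
  quantum_channel Phi -> trnorm (ampliation Phi X) <= trnorm X.
Proof.
case=> _ cp tp; have [_ [S [T [_ _ XE SS TT]]]] := trnorm_polar X.
apply: (trnorm_psd2 (P := ampliation Phi (S *m S^t*))
                    (Q := ampliation Phi (T *m T^t*))).
  by apply: completely_positive_psd2 => //; rewrite [X in psd2 _ X]XE;
    exact: psd2_mul_adj.
by rewrite !trace_preserving_ampliation // SS TT -rmorphD -mulr2n.
Qed.

End Ampliation.

(** * Lindblad generators *)

Section Lindblad.
Variable R : realType.
Local Notation C := R[i].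
Implicit Types D : nat.

Definition sqnorm D (v : 'cV[C]_D) := (v^t* *m v) 0 0.

(** The form inequality [A^* A <= c]: here [c] bounds the square of the norm, so that neither roots
    nor extended reals enter. *)
Definition sq_bounded D (A : 'M[C]_D) (c : R) :=
  forall v, sqnorm (A *m v) <= c%:C%C * sqnorm v.

Lemma conjC_real (r : R) : conjC (r%:C%C : C) = r%:C%C.
Proof. by apply/CrealP/complex_realP; exists r. Qed.

Lemma sqnorm_ge0 D (v : 'cV[C]_D) : 0 <= sqnorm v.
Proof.
rewrite /sqnorm -trace_mx11 -[X in _ *m X]trmxCK.
exact: mxtrace_mul_adj_ge0.
Qed.

Lemma sqnormZ D c (v : 'cV[C]_D) : sqnorm (c *: v) = `|c| ^+ 2 * sqnorm v.
Proof.
by rewrite /sqnorm adjmxZ -scalemxAl -scalemxAr scalerA mxE normCKC.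
Qed.

Lemma sqnormD D (u v : 'cV[C]_D) : sqnorm (u + v) =
  sqnorm u + (u^t* *m v) 0 0 + (v^t* *m u) 0 0 + sqnorm v.
Proof.
by rewrite /sqnorm adjmxD !(mulmxDl, mulmxDr) !addmxE !addrA.
Qed.

Lemma sqnormDsub D (u v : 'cV[C]_D) :
  sqnorm (u + v) + sqnorm (u - v) = 2 * sqnorm u + 2 * sqnorm v.
Proof.
rewrite !sqnormD /sqnorm adjmxN !(mulmxN, mulNmx, opprK) !oppmxE.
by move: (_ 0 0) (_ 0 0) (_ 0 0) (_ 0 0) => a b c d; ring.
Qed.

Lemma sqnormD_le D (u v : 'cV[C]_D) :
  sqnorm (u + v) <= 2 * sqnorm u + 2 * sqnorm v.
Proof. by rewrite -sqnormDsub lerDl sqnorm_ge0. Qed.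

Lemma sq_bounded_mul D (A B : 'M[C]_D) (a b : R) : 0 <= a ->
  sq_bounded A a -> sq_bounded B b -> sq_bounded (A *m B) (a * b).
Proof.
move=> a0 hA hB v; rewrite -mulmxA; apply: le_trans (hA _) _.
by rewrite rmorphM -mulrA ler_wpM2l // ler0c.
Qed.

(** Expanding [|A A^* v - a v|^2 >= 0] and bounding [|A A^* v|^2] by [a |A^* v|^2] leaves
    [a |A^* v|^2 <= a^2 |v|^2]. *)
Lemma sq_bounded_adj D (A : 'M[C]_D) (a : R) : 0 < a ->
  sq_bounded A a -> sq_bounded (A^t*) a.
Proof.
move=> a0 hA v; have a0' : 0 < a%:C%C :> C by rewrite ltcR.
have := sqnorm_ge0 (A *m (A^t* *m v) - a%:C%C *: v).
rewrite -scaleNr sqnormD sqnormZ normrN (ger0_norm (ltW a0')).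
have e1 : ((A *m (A^t* *m v))^t* *m (- a%:C%C *: v)) 0 0 =
    - a%:C%C * sqnorm (A^t* *m v).
  by rewrite -scalemxAr scalemxE adjmxM -mulmxA.
have e2 : ((- a%:C%C *: v)^t* *m (A *m (A^t* *m v))) 0 0 =
    - a%:C%C * sqnorm (A^t* *m v).
  rewrite adjmxZ -scalemxAl scalemxE rmorphN /= (CrealP (gtr0_real a0')).
  by rewrite /sqnorm adjmxM trmxCK -(mulmxA (v^t*)).
rewrite e1 e2; have := hA (A^t* *m v).
move: (sqnorm _) (sqnorm _) (sqnorm _) => x y z h1 h2.
rewrite -(ler_pM2l a0') -subr_ge0.
rewrite -subr_ge0 in h1; have := addr_ge0 h1 h2; congr (0 <= _); ring.
Qed.

Section Generator.
Variables (D : nat) (H V : 'M[C]_D).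
Hypothesis H_adj : H^t* = H.

(** The no-jump part of the generator: [i K] is the effective non-Hermitian Hamiltonian. *)
Definition lindblad_left : 'M[C]_D := - 'i *: H - 2^-1 *: (V^t* *m V).

Local Notation K := lindblad_left.

Lemma lindblad_left_adj : K^t* = 'i *: H - 2^-1 *: (V^t* *m V).
Proof.
rewrite adjmxD adjmxN !adjmxZ adjmxM trmxCK H_adj rmorphN /= conjCi opprK.
by rewrite fmorphV /= rmorph_nat.
Qed.

Lemma lindbladE X : lindblad H V X = K *m X + X *m K^t* + V *m X *m V^t*.
Proof.
rewrite lindblad_left_adj /lindblad /K !(mulmxDl, mulmxDr, mulmxN, mulNmx).
rewrite -!scalemxAl -!scalemxAr !(scalerDr, scalerN, scaleNr) !mulmxA.
have zmod_id (Z : zmodType) (a b c d e : Z) :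
    - a - - b + c - (d + e) = - a - d + (b - e) + c.
  by rewrite opprK opprD addrAC addrACA.
exact: zmod_id.
Qed.

Lemma lindblad_linear : linear (lindblad H V).
Proof.
move=> c X Y; rewrite !lindbladE; move: K (K^t*) => A B.
rewrite !(mulmxDl, mulmxDr) -!scalemxAl -!scalemxAr.
rewrite -!scalemxAl !scalerDr.
have zmod_id (Z : zmodType) (a b d a' b' d' : Z) :
    a + a' + (b + b') + (d + d') = a + b + d + (a' + b' + d').
  by rewrite (addrACA a a') (addrACA (a + b)).
exact: zmod_id.
Qed.

Lemma lindblad_kraus (s : R) X : 0 <= s ->
  X + s%:C%C *: lindblad H V X =
  ((1%:M + s%:C%C *: K) *m X *m (1%:M + s%:C%C *: K)^t* +
   (Num.sqrt s)%:C%C *: V *m X *m ((Num.sqrt s)%:C%C *: V)^t*)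
  - (s ^+ 2)%:C%C *: (K *m X *m K^t*).
Proof.
move=> s0.
have eA : (1%:M + s%:C%C *: K) *m X *m (1%:M + s%:C%C *: K)^t* =
    X + s%:C%C *: (K *m X) + s%:C%C *: (X *m K^t*) +
    (s ^+ 2)%:C%C *: (K *m X *m K^t*).
  move: K (K^t*) (adjmxZ s%:C%C K) => A B.
  rewrite adjmxD adjmx1 conjC_real => ->; rewrite !(mulmxDl, mulmxDr) !(mul1mx, mulmx1).
  by rewrite -!scalemxAr -!scalemxAl scalerA expr2 rmorphM !addrA [X + _ + _]addrAC.
have eB : ((Num.sqrt s)%:C%C *: V *m X *m ((Num.sqrt s)%:C%C *: V)^t*) =
    s%:C%C *: (V *m X *m V^t*).
  rewrite adjmxZ conjC_real -!scalemxAr -!scalemxAl scalerA -rmorphM /=.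
  by rewrite -expr2 sqr_sqrtr.
rewrite eA eB lindbladE !scalerDr.
have zmod_id (Z : zmodType) (x a b d e : Z) :
    x + (a + b + d) = x + a + b + e + d - e.
  by rewrite [x + a + b + e + d]addrAC addrK !addrA.
exact: zmod_id.
Qed.

(** The parallelogram estimate gives [2 l^2 + 2 l^2 / 4], rounded up to [3 l^2]. *)
Lemma sq_bounded_lindblad_left (l : R) : 0 < l ->
  sq_bounded H (l ^+ 2) -> sq_bounded V l -> sq_bounded K (3 * l ^+ 2).
Proof.
move=> l0 hH hV v; rewrite /K mulmxDl mulNmx -!scalemxAl.
apply: le_trans (sqnormD_le _ _) _.
have -> : sqnorm (- (2^-1 *: (V^t* *m V *m v))) =
   4^-1 * sqnorm (V^t* *m V *m v).
  rewrite -scaleNr sqnormZ normrN normfV normr_nat; congr (_ * _).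
  by rewrite exprVn -natrX.
rewrite sqnormZ normrN normCi expr1n mul1r.
have h1 := hH v.
have h2 := sq_bounded_mul (ltW l0) (sq_bounded_adj l0 hV) hV v.
have lpos : 0 <= (l ^+ 2)%:C%C * sqnorm v.
  by rewrite mulr_ge0 ?sqnorm_ge0 // ler0c sqr_ge0.
rewrite -expr2 in h2.
rewrite rmorphM rmorph_nat -mulrA.
apply: (@le_trans _ _ (2 * ((l ^+ 2)%:C%C * sqnorm v) +
  2 * (4^-1 * ((l ^+ 2)%:C%C * sqnorm v)))).
  by rewrite lerD // ler_pM2l // ler_pM2l // invr_gt0.
rewrite -subr_ge0.
have -> : 3 * ((l ^+ 2)%:C%C * sqnorm v) - (2 * ((l ^+ 2)%:C%C * sqnorm v) +
  2 * (4^-1 * ((l ^+ 2)%:C%C * sqnorm v))) = 2^-1 * ((l ^+ 2)%:C%C * sqnorm v).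
  by field.
by rewrite mulr_ge0 // invr_ge0.
Qed.

Lemma sqnorm_euler (s : R) v : 0 <= s ->
  sqnorm ((1%:M + s%:C%C *: K) *m v) + sqnorm ((Num.sqrt s)%:C%C *: V *m v) =
  sqnorm v + (s ^+ 2)%:C%C * sqnorm (K *m v).
Proof.
move=> s0; have s0' : 0 <= s%:C%C :> C by rewrite ler0c.
have VV : V^t* *m V = - (K + K^t*).
  rewrite lindblad_left_adj /K addrACA -scalerDl addNr scale0r add0r.
  by rewrite -opprD opprK -scalerDl -[2^-1]div1r -splitr scale1r.
rewrite mulmxDl mul1mx -!scalemxAl sqnormD !sqnormZ !ger0_norm ?ler0c ?sqrtr_ge0 //.
rewrite -!rmorphXn /= sqr_sqrtr // -scalemxAr scalemxE.
rewrite adjmxZ conjC_real -scalemxAl scalemxE adjmxM.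
have -> : sqnorm (V *m v) =
    - ((v^t* *m (K *m v)) 0 0 + (v^t* *m K^t* *m v) 0 0).
  rewrite /sqnorm adjmxM -mulmxA [V^t* *m _]mulmxA VV mulNmx mulmxN oppmxE.
  by rewrite mulmxDl mulmxDr addmxE !mulmxA.
ring.
Qed.

(** The constant 6 is 3 from the Kraus part plus 3 from the subtracted [s^2 K X K^*]. *)
Lemma trnorm_lindblad_euler (l s : R) X : 0 < l -> 0 <= s ->
  sq_bounded H (l ^+ 2) -> sq_bounded V l ->
  trnorm (X + s%:C%C *: lindblad H V X) <= (1 + 6 * l ^+ 2 * s ^+ 2) * trnorm X.
Proof.
move=> l0 s0 hH hV; rewrite lindblad_kraus //.
have hK := sq_bounded_lindblad_left l0 hH hV.
apply: le_trans (trnormD _ _) _.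
have -> : (1 + 6 * l ^+ 2 * s ^+ 2) * trnorm X =
  (1 + 3 * l ^+ 2 * s ^+ 2) * trnorm X + s ^+ 2 * (3 * l ^+ 2 * trnorm X) by ring.
apply: lerD.
  apply: trnorm_kraus2 => v.
  rewrite -!/(sqnorm _) sqnorm_euler // rmorphD /= mulrDl mul1r lerD2l.
  have -> : real_complex R (3 * l ^+ 2 * s ^+ 2) =
    (s ^+ 2)%:C%C * (3 * l ^+ 2)%:C%C by rewrite -rmorphM mulrC.
  by rewrite -mulrA; apply: ler_wpM2l; [rewrite ler0c sqr_ge0 | exact: hK].
rewrite -scaleNr; apply: le_trans (trnormZ_le (r := s ^+ 2) _ _) _.
  by rewrite normrN ger0_norm // ler0c sqr_ge0.
rewrite ler_wpM2l ?sqr_ge0 //.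
have := @trnorm_kraus2 _ _ K 0 X (3 * l ^+ 2); rewrite !mul0mx addr0; apply.
by move=> v; rewrite mul0mx mulmx0 [X in _ + X]mxE addr0; exact: hK.
Qed.

(** Read off from the Euler step of length [1 / l]: that step has norm at most [1 + 6], removing [X]
    costs 1 more, and rescaling gives [8 l]. *)
Lemma trnorm_lindblad (l : R) X : 0 < l ->
  sq_bounded H (l ^+ 2) -> sq_bounded V l ->
  trnorm (lindblad H V X) <= 8 * l * trnorm X.
Proof.
move=> l0 hH hV; have li0 : 0 <= l^-1 by rewrite invr_ge0 ltW.
have h := trnorm_lindblad_euler X l0 li0 hH hV.
have -> : lindblad H V X =
    l%:C%C *: ((X + (l^-1)%:C%C *: lindblad H V X) - X).
  by rewrite addrAC subrr add0r scalerA -rmorphM mulfV ?gt_eqF // scale1r.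
apply: le_trans (trnormZ_le (r := l) _ _) _.
  by rewrite ger0_norm // ler0c ltW.
rewrite [8 * l]mulrC -mulrA ler_pM2l //; apply: le_trans (trnormD _ _) _.
have -> : 8 * trnorm X = (1 + 6 * l ^+ 2 * l^-1 ^+ 2) * trnorm X + 1 * trnorm X.
  by field; rewrite gt_eqF.
apply: lerD => //; rewrite -scaleN1r; apply: trnormZ_le.
by rewrite normrN1.
Qed.

End Generator.
End Lindblad.

(** * Ampliated generators and the spectral norm *)

Section LindbladAmpliation.
Variables (R : realType) (N : nat).
Local Notation C := R[i].
Implicit Types A H V : 'M[C]_N.

Lemma sqnorm_mxcol k (u : 'I_k -> 'cV[C]_N) :
  sqnorm (\mxcol_i u i) = \sum_i sqnorm (u i).
Proof. by rewrite /sqnorm adj_mxcol mul_mxrow_mxcol summxE. Qed.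

Lemma sq_bounded_mxdiag k A (c : R) :
  sq_bounded A c -> sq_bounded (\mxdiag_(_ < k) A) c.
Proof.
move=> h v; rewrite -[v]submxcolK mul_mxdiag_mxcol !sqnorm_mxcol mulr_sumr.
by apply: ler_sum => i _; exact: h.
Qed.

Lemma adj_mxdiag k A : (\mxdiag_(_ < k) A)^t* = \mxdiag_(_ < k) A^t*.
Proof.
rewrite tr_mxdiag; apply/matrixP=> s t; rewrite !mxE.
by case: eqP => e; rewrite ?mxE ?rmorph0 //; case: _ / e; rewrite !conform_mx_id !mxE.
Qed.

(** The ampliated generator is again of Lindblad form, and block diagonal copies keep the bounds on
    [H] and [V]. The estimates for plain matrices thus apply with constants free of the
    dimension. *)
Lemma ampliation_lindblad k H V (X : 'M[C]_(\sum_(_ < k) N)) :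
  ampliation (lindblad H V) X =
  lindblad (\mxdiag_(_ < k) H) (\mxdiag_(_ < k) V) X.
Proof.
rewrite /lindblad adj_mxdiag -[_ *m _ *m X]mulmxA [X *m (_ *m _)]mulmxA.
rewrite -[X in RHS]submxblockK !(mul_mxdiag_mxblock, mul_mxblock_mxdiag).
apply/matrixP=> s t; rewrite ampliationE [RHS]mxE.
rewrite /lindblad -[_ *m _ *m submxblock _ _ _]mulmxA [submxblock _ _ _ *m (_ *m _)]mulmxA.
by rewrite !(addmxE, oppmxE, scalemxE) ![(\mxblock_(_, _) _) _ _]mxE.
Qed.

Lemma vnorm_sq (v : 'cV[C]_N) : (vnorm v ^+ 2)%:C%C = sqnorm v.
Proof.
have v0 := sqnorm_ge0 v.
rewrite /vnorm sqr_sqrtr; last by rewrite -ler0c RRe_real // ger0_real.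
by rewrite RRe_real // ger0_real.
Qed.

Lemma sq_bounded_unit A (c : R) :
  (forall u, vnorm u = 1 -> vnorm (A *m u) ^+ 2 <= c) -> sq_bounded A c.
Proof.
move=> h v; have v0 := sqnorm_ge0 v.
have [s0|s0] := eqVneq (sqnorm v) 0.
  have -> : v = 0.
    have := @mxtrace_mul_adj_eq0 _ _ _ (v^t*).
    rewrite trmxCK trace_mx11 => /(_ s0) va0.
    by rewrite -[v]trmxCK va0 trmx0 map_mx0.
  by rewrite mulmx0 -{1 2}(scale0r (0 : 'cV_N)) !sqnormZ normr0 expr0n !mul0r mulr0.
pose r := vnorm v.
have r0 : 0 < r.
  rewrite lt0r sqrtr_ge0 andbT; apply: contraNneq s0 => r0.
  by rewrite -vnorm_sq -/r r0 expr0n.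
pose u := (r^-1)%:C%C *: v.
have sq (w : 'cV[C]_N) : vnorm w = Num.sqrt (complex.Re (sqnorm w)) by [].
have u1 : vnorm u = 1.
  rewrite sq /u sqnormZ -vnorm_sq -/r ger0_norm ?ler0c ?invr_ge0 ?ltW //.
  rewrite -rmorphXn -rmorphM /= -exprMn mulVf ?gt_eqF // expr1n.
  by rewrite sqrtr1.
have := h u u1.
rewrite -lecR vnorm_sq /u -scalemxAr sqnormZ.
have ri0 : 0 <= r^-1 by rewrite invr_ge0 ltW.
rewrite ger0_norm ?ler0c // -rmorphXn /= => h1.
have r2 : 0 < (r ^+ 2)%:C%C :> C by rewrite ltcR exprn_gt0.
rewrite -(vnorm_sq v) -/r mulrC -ler_pdivrMl // -fmorphV /= -exprVn.
exact: h1.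
Qed.

Lemma opnorm_sq_bounded A (l : R) :
  0 <= l -> (opnorm A <= l%:E)%E -> sq_bounded A (l ^+ 2).
Proof.
move=> l0 h; apply: sq_bounded_unit => u u1.
apply: lerXn2r; rewrite ?nnegrE ?sqrtr_ge0 // -lee_fin.
by apply: le_trans h; apply: ereal_sup_ubound; exists u.
Qed.

Lemma opnorm_sqr_sq_bounded A (l : R) :
  (opnorm A ^+ 2 <= l%:E)%E -> sq_bounded A l.
Proof.
move=> h; apply: sq_bounded_unit => u u1; rewrite -lee_fin.
apply: le_trans h; rewrite expe2 EFinM.
have uA : ((vnorm (A *m u))%:E <= opnorm A)%E.
  by apply: ereal_sup_ubound; exists u.
by apply: lee_pmul => //; rewrite lee_fin sqrtr_ge0.
Qed.

End LindbladAmpliation.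

(** * Averages *)

Section MatrixMean.
Variables (R : realType) (d : measure_display) (A : measurableType d).
Variables (mu : probability A R) (D : nat).
Local Notation C := R[i].
Implicit Types Z : A -> 'M[C]_D.

(** On a probability space this makes every entry integrable, and it is stable under linear
    combinations. *)
Definition bounded_measurable_mx Z :=
  (exists r : R, forall a i j, `|Z a i j| <= r%:C%C) /\
  forall i j, measurable_fun [set: A] (fun a => complex.Re (Z a i j)) /\
    measurable_fun [set: A] (fun a => complex.Im (Z a i j)).

Definition mxmean Z : 'M[C]_D := \matrix_(i, j)
  ((\int[mu]_a complex.Re (Z a i j)) +i* (\int[mu]_a complex.Im (Z a i j)))%C.

Lemma le_norm_Re (z : C) (r : R) : `|z| <= r%:C%C -> `|complex.Re z| <= r.
Proof. by move=> h; rewrite -lecR; apply: le_trans h; exact: normc_ge_Re. Qed.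

Lemma le_norm_Im (z : C) (r : R) : `|z| <= r%:C%C -> `|complex.Im z| <= r.
Proof.
move=> h; have -> : complex.Im z = - complex.Re (z * 'i%C) by rewrite ReiNIm opprK.
rewrite normrN; apply: le_norm_Re; rewrite normrM.
by rewrite complexiE normCi mulr1.
Qed.

Lemma bounded_integrable (f : A -> R) (r : R) :
  measurable_fun [set: A] f -> (forall a, `|f a| <= r) ->
  mu.-integrable [set: A] (EFin \o f).
Proof.
move=> mf fr; apply: measurable_bounded_integrable => //.
- by apply: le_lt_trans (probability_le1 mu measurableT) _; rewrite ltry.
- exists r; split; first exact: num_real.
  by move=> x rx a _; apply: le_trans (fr a) (ltW rx).
Qed.

Lemma integrable_Re Z i j : bounded_measurable_mx Z ->
  mu.-integrable [set: A] (EFin \o (fun a => complex.Re (Z a i j))).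
Proof.
case=> -[r hr] hm; apply: (@bounded_integrable _ r); first by case: (hm i j).
by move=> a; exact: le_norm_Re.
Qed.

Lemma integrable_Im Z i j : bounded_measurable_mx Z ->
  mu.-integrable [set: A] (EFin \o (fun a => complex.Im (Z a i j))).
Proof.
case=> -[r hr] hm; apply: (@bounded_integrable _ r); first by case: (hm i j).
by move=> a; exact: le_norm_Im.
Qed.

Lemma bounded_measurable_mx_lin (c : C) Z1 Z2 :
  bounded_measurable_mx Z1 -> bounded_measurable_mx Z2 ->
  bounded_measurable_mx (fun a => c *: Z1 a + Z2 a).
Proof.
move=> [[r1 h1] m1] [[r2 h2] m2]; split.
  have /complex_realP[n nE] := normr_real c.
  exists (n * r1 + r2) => a i j; rewrite !mxE.
  apply: le_trans (ler_normD _ _) _; rewrite rmorphD rmorphM /= normrM -nE.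
  by rewrite lerD // ler_wpM2l.
move=> i j; have [[a1 b1] [a2 b2]] := (m1 i j, m2 i j); case: c => x y.
split.
  have -> : (fun a => complex.Re (((x +i* y)%C *: Z1 a + Z2 a) i j)) =
    (fun a => (x * complex.Re (Z1 a i j) - y * complex.Im (Z1 a i j))
       + complex.Re (Z2 a i j)).
    by apply/funext => a; rewrite !mxE; case: (Z1 a i j) (Z2 a i j) => [? ?] [? ?].
  apply: measurable_realfun.measurable_funD => //; apply: measurable_realfun.measurable_funB; exact: measurable_realfun.measurable_funM.
have -> : (fun a => complex.Im (((x +i* y)%C *: Z1 a + Z2 a) i j)) =
    (fun a => (x * complex.Im (Z1 a i j) + y * complex.Re (Z1 a i j))
       + complex.Im (Z2 a i j)).
  by apply/funext => a; rewrite !mxE; case: (Z1 a i j) (Z2 a i j) => [? ?] [? ?].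
apply: measurable_realfun.measurable_funD => //; apply: measurable_realfun.measurable_funD; exact: measurable_realfun.measurable_funM.
Qed.

Lemma bounded_measurable_mx_cst X : bounded_measurable_mx (fun=> X).
Proof.
split; last by move=> i j; split; exact: measurable_cst.
by exists (trnorm X) => a i j; exact: le_trnorm_entry.
Qed.

Lemma Rintegral_probability_cst (x : R) : \int[mu]_(a in [set: A]) x = x.
Proof.
rewrite Rintegral_cst //.
rewrite -[RHS]mulr1; congr (_ * _).
exact: (congr1 fine (probability_setT mu)).
Qed.

Lemma mxmean_cst X : mxmean (fun=> X) = X.
Proof.
apply/matrixP=> i j; rewrite mxE !Rintegral_probability_cst.
by case: (X i j).
Qed.

Lemma integrable_real (f : A -> R) (x : R) :
  mu.-integrable [set: A] (EFin \o f) ->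
  mu.-integrable [set: A] (EFin \o (fun a => x * f a)).
Proof. by move=> h; exact: (integrableZl measurableT x h). Qed.

Lemma mxmean_lin (c : C) Z1 Z2 :
  bounded_measurable_mx Z1 -> bounded_measurable_mx Z2 ->
  mxmean (fun a => c *: Z1 a + Z2 a) = c *: mxmean Z1 + mxmean Z2.
Proof.
move=> b1 b2; apply/matrixP=> i j; rewrite !mxE; case: c => x y.
have [r1 i1 r2 i2] := And4 (integrable_Re i j b1) (integrable_Im i j b1)
  (integrable_Re i j b2) (integrable_Im i j b2).
apply/eqP; rewrite eq_complex /=; apply/andP; split; apply/eqP.
  have -> : (fun a => complex.Re (((x +i* y)%C *: Z1 a + Z2 a) i j)) =
    (fun a => (x * complex.Re (Z1 a i j) + (- y) * complex.Im (Z1 a i j))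
       + complex.Re (Z2 a i j)).
    by apply/funext => a; rewrite !mxE; case: (Z1 a i j) (Z2 a i j) => [? ?] [? ?];
      rewrite /= mulNr.
  rewrite RintegralD //; last first.
    exact: (integrableD measurableT (integrable_real x r1) (integrable_real (- y) i1)).
  rewrite RintegralD // ?RintegralZl // ?mulNr //; exact: integrable_real.
have -> : (fun a => complex.Im (((x +i* y)%C *: Z1 a + Z2 a) i j)) =
    (fun a => (x * complex.Im (Z1 a i j) + y * complex.Re (Z1 a i j))
       + complex.Im (Z2 a i j)).
  by apply/funext => a; rewrite !mxE; case: (Z1 a i j) (Z2 a i j) => [? ?] [? ?].
rewrite RintegralD //; last first.
  exact: (integrableD measurableT (integrable_real x i1) (integrable_real y r1)).
rewrite RintegralD // ?RintegralZl //; exact: integrable_real.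
Qed.

(** Integrability is carried along because additivity of the integral asks for it at each step of
    the induction. *)
Lemma Rintegral_sum (I : finType) (f : I -> A -> R) :
  (forall i, mu.-integrable [set: A] (EFin \o f i)) ->
  \int[mu]_a (\sum_i f i a) = \sum_i \int[mu]_a f i a /\
  mu.-integrable [set: A] (EFin \o (fun a => \sum_i f i a)).
Proof.
move=> h; rewrite -big_enum.
have -> : (fun a => \sum_i f i a) = (fun a => \sum_(i <- enum I) f i a).
  by apply/funext => a; rewrite big_enum.
elim: (enum I) => [|i s [IH1 IH2]].
  have -> : (fun a => \sum_(i <- [::]) f i a) = (fun=> 0).
    by apply/funext => a; rewrite big_nil.
  by rewrite big_nil Rintegral_cst // mul0r; split=> //; exact: integrable0.
have -> : (fun a => \sum_(j <- i :: s) f j a) =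
    (fun a => f i a + \sum_(j <- s) f j a).
  by apply/funext => a; rewrite big_cons.
rewrite big_cons RintegralD // IH1; split=> //.
exact: (integrableD measurableT (h i) IH2).
Qed.

(** Only one functional is integrated, the one that attains the norm of the mean. It is a finite
    real combination of entries, so measurability of [trnorm (Z a)] never comes up. *)
Lemma trnorm_mxmean Z (c : R) : bounded_measurable_mx Z ->
  (forall a, trnorm (Z a) <= c) -> trnorm (mxmean Z) <= c.
Proof.
move=> bZ Zc; have [W [<- hW]] := trnorm_dual (mxmean Z).
have trE (X : 'M[C]_D) : complex.Re (\tr (W *m X)) = \sum_(k : 'I_D * 'I_D)
    (complex.Re (W k.1 k.2) * complex.Re (X k.2 k.1) +
     (- complex.Im (W k.1 k.2)) * complex.Im (X k.2 k.1)).
  rewrite raddf_sum /=.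
  rewrite -(pair_bigA _ (fun i j => complex.Re (W i j) * complex.Re (X j i) +
     (- complex.Im (W i j)) * complex.Im (X j i))) /=.
  apply: eq_bigr => i _; rewrite mxE raddf_sum /=; apply: eq_bigr => j _.
  by case: (W i j) (X j i) => [? ?] [? ?]; rewrite /= mulNr.
have intk (k : 'I_D * 'I_D) : mu.-integrable [set: A] (EFin \o (fun a =>
    complex.Re (W k.1 k.2) * complex.Re (Z a k.2 k.1) +
     (- complex.Im (W k.1 k.2)) * complex.Im (Z a k.2 k.1))).
  exact: (integrableD measurableT
    (integrable_real (complex.Re (W k.1 k.2)) (integrable_Re k.2 k.1 bZ))
    (integrable_real (- complex.Im (W k.1 k.2)) (integrable_Im k.2 k.1 bZ))).
have [sumE sumI] := Rintegral_sum intk.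
have -> : complex.Re (\tr (W *m mxmean Z)) =
    \int[mu]_a complex.Re (\tr (W *m Z a)).
  under [RHS]eq_Rintegral do rewrite trE.
  rewrite sumE trE; apply: eq_bigr => k _; rewrite RintegralD //.
  - by rewrite !RintegralZl ?mxE //; [exact: integrable_Im|exact: integrable_Re].
  - exact/integrable_real/integrable_Re.
  - exact/integrable_real/integrable_Im.
have -> : c = \int[mu]_(a in [set: A]) c.
  by rewrite Rintegral_probability_cst.
apply: le_Rintegral => //.
- by under eq_fun do rewrite trE.
- by apply: (@bounded_integrable _ `|c|) => //; exact: measurable_cst.
- by move=> a _; apply: le_trans (hW _) (Zc a).
Qed.

End MatrixMean.

Section AmpliationMean.
Variables (R : realType) (d : measure_display) (A : measurableType d).
Variables (mu : probability A R) (N k : nat).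
Local Notation C := R[i].

Lemma ampliation_mean (Phi : A -> superop R N) (X : 'M[C]_(\sum_(_ < k) N)) :
  ampliation (superop_mean mu Phi) X = mxmean mu (fun a => ampliation (Phi a) X).
Proof.
apply/matrixP=> s t; rewrite ampliationE !mxE.
by congr Complex; apply: eq_Rintegral => a _; rewrite ampliationE.
Qed.

Lemma ampliation_bounded_measurable (Phi : A -> superop R N) r
    (X : 'M[C]_(\sum_(_ < k) N)) :
  measurable_superop Phi -> (forall a, trnorm (ampliation (Phi a) X) <= r) ->
  bounded_measurable_mx (fun a => ampliation (Phi a) X).
Proof.
move=> mPhi hr; split.
  exists r => a i j; apply: le_trans (le_trnorm_entry _ _ _) _.
  by rewrite lecR.
move=> s t; have [m1 m2] := mPhi (submxblock X (tagnat.sig1 s) (tagnat.sig1 t))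
  (tagnat.sig2 s) (tagnat.sig2 t).
by split; under eq_fun do rewrite ampliationE.
Qed.

End AmpliationMean.

(** * The exponential of a superoperator *)

Section SuperopExp.
Variables (R : realType) (N : nat).
Local Notation C := R[i].

Lemma norm_le_ReIm (z : C) :
  `|z| <= (`|complex.Re z| + `|complex.Im z|)%:C%C.
Proof.
rewrite {1}[z]complexE; apply: le_trans (ler_normD _ _) _.
rewrite complexiE normrM normCi mul1r rmorphD /=.
by rewrite lerD // normc_def /= expr0n addr0 sqrtr_sqr.
Qed.

(** [limn] is meaningful only once convergence is known. The candidate limit [M] is assembled from
    real and imaginary parts of the entries, whose series converge absolutely by domination. *)
Lemma mx_series_lim (w : nat -> 'M[C]_N) (u : nat -> R) :
  cvgn (series u) -> (forall m i j, `|w m i j| <= (u m)%:C%C) ->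
  forall eps : R, 0 < eps -> \forall n \near \oo, forall i j,
  `|limn (series (w : nat -> 'M[C^o]_N)) i j - (\sum_(m < n) w m) i j|
    <= eps%:C%C.
Proof.
move=> cu wu.
(* An index is required: for [N = 0] the entrywise bound says nothing about [u]. *)
have u0 m (i : 'I_N) : 0 <= u m.
  by rewrite -ler0c; apply: le_trans (normr_ge0 _) (wu m i i).
have cvg_part (f : nat -> R) (i : 'I_N) : (forall m, `|f m| <= u m) ->
    cvgn (series f).
  move=> fu; apply: normed_cvg; apply: (series_le_cvg _ _ _ cu) => m; [exact: normr_ge0|exact: (u0 m i)|exact: fu].
have cRe i j : cvgn (series (fun m => complex.Re (w m i j))).
  by apply: (cvg_part _ i) => m; exact: le_norm_Re.
have cIm i j : cvgn (series (fun m => complex.Im (w m i j))).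
  by apply: (cvg_part _ i) => m; exact: le_norm_Im.
pose M : 'M[C]_N := \matrix_(i, j)
  (limn (series (fun m => complex.Re (w m i j))) +i*
   limn (series (fun m => complex.Im (w m i j))))%C.
have key (eps : R) : 0 < eps -> \forall n \near \oo, forall i j,
    `|M i j - (\sum_(m < n) w m) i j| < eps%:C%C.
  move=> e0; apply: filter_forall => i; apply: filter_forall => j.
  have e2 : 0 < eps / 2 by rewrite divr_gt0.
  near=> n.
  apply: le_lt_trans (norm_le_ReIm _) _; rewrite ltcR [eps]splitr.
  rewrite !mxE summxE !raddfB !raddf_sum /=.
  rewrite !sumrN; apply: ltrD.
    have -> : \sum_(m < n) complex.Re (w m i j) =
      series (fun m => complex.Re (w m i j)) n by rewrite /series /= big_mkord.
    by near: n; exact: (cvgr_dist_lt _ _ (cRe i j) _ e2).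
  have -> : \sum_(m < n) complex.Im (w m i j) =
    series (fun m => complex.Im (w m i j)) n by rewrite /series /= big_mkord.
  by near: n; exact: (cvgr_dist_lt _ _ (cIm i j) _ e2).
have -> : limn (series (w : nat -> 'M[C^o]_N)) = M.
  apply: cvg_lim; first exact: norm_hausdorff.
  apply/cvg_ballP => eps eps0.
  (* Radii of balls are positive elements of [R[i]], hence real. *)
  have epsE : eps = (complex.Re eps)%:C%C by rewrite RRe_real // gtr0_real.
  have e0 : 0 < complex.Re eps by rewrite -ltcR -epsE.
  near=> n; split=> // i j; rewrite /ball /= /series /= big_mkord epsE.
  by move: i j; near: n; exact: key.
move=> eps e0; apply: filterS (key _ e0) => n h i j; exact/ltW/h.
Unshelve. all: by end_near.
Qed.

(** The factor depends on the dimension, harmlessly: it serves only to turn entrywise convergence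
    into convergence in trace norm. *)
Lemma trnorm_le_entries D (X : 'M[C]_D) (e : R) :
  (forall i j, `|X i j| <= e%:C%C) ->
  trnorm X <= e * \sum_i \sum_j trnorm (delta_mx i j : 'M[C]_D).
Proof.
move=> h; rewrite {1}[X]matrix_sum_delta mulr_sumr.
apply: le_trans (seminorm_sum (@trnormD R D) (@trnormZ_le R D) _) _.
apply: ler_sum => i _; rewrite mulr_sumr.
apply: le_trans (seminorm_sum (@trnormD R D) (@trnormZ_le R D) _) _.
by apply: ler_sum => j _; exact: trnormZ_le.
Qed.

Lemma trnorm_superop_exp k (Psi : superop R N) (b c : R)
    (X Y : 'M[C]_(\sum_(_ < k) N)) :
  0 <= b -> bounded_by (@trnorm R _) (ampliation (k := k) Psi) b ->
  (exists n0, forall n, (n0 <= n)%N ->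
    trnorm (exp_partial (ampliation Psi) n X - Y) <= c) ->
  trnorm (ampliation (superop_exp Psi) X - Y) <= c.
Proof.
move=> b0 hb [n0 hn0]; apply/ler_addgt0Pr => eps e0.
pose K : R := \sum_i \sum_j trnorm (delta_mx i j : 'M[C]_(\sum_(h < k) N)).
have K0 : 0 <= K by apply: sumr_ge0 => s _; apply: sumr_ge0 => t _; exact: trnorm_ge0.
pose e := eps / (K + 1).
have K1 : 0 < K + 1 by rewrite ltr_wpDl.
have e1 : 0 < e by rewrite divr_gt0.
pose w i j m : 'M[C]_N := m`!%:R^-1 *: iter m Psi (submxblock X i j).
pose u m : R := trnorm X * exp_coeff b m.
have cu : cvgn (series u) by apply: is_cvg_seriesZ; exact: is_cvg_series_exp_coeff.
(* The bound [b] concerns the ampliation, the series runs inside each block; an entry of a block is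
   an entry of the ampliated iterate, hence below its trace norm. *)
have wu i j m s t : `|w i j m s t| <= (u m)%:C%C.
  have -> : w i j m = submxblock (m`!%:R^-1 *: ampliation (iter m Psi) X) i j.
    apply/matrixP=> s' t'; rewrite [RHS]mxE [RHS]mxE [LHS]mxE.
    congr (_ * _); move/matrixP: (mxblockK
      (fun i j => iter m Psi (submxblock X i j)) i j) => /(_ s' t').
    by rewrite [X in X = _]mxE.
  rewrite [_ s t]mxE; apply: le_trans (le_trnorm_entry _ _ _) _; rewrite lecR.
  have mf : `|m`!%:R^-1 : C| <= (m`!%:R^-1 : R)%:C%C.
    by rewrite fmorphV rmorph_nat normfV normr_nat.
  apply: le_trans (trnormZ_le _ mf) _.
  have -> : u m = m`!%:R^-1 * (b ^+ m * trnorm X) by rewrite /u /exp_coeff /=; ring.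
  rewrite ler_wpM2l ?invr_ge0 // ampliation_iter.
  exact: bounded_by_iter.
have hlim : \forall n \near \oo, forall i j s t,
    `|superop_exp Psi (submxblock X i j) s t - (\sum_(m < n) w i j m) s t| <= e%:C%C.
  apply: filter_forall => i; apply: filter_forall => j.
  exact: (mx_series_lim cu (wu i j) e1).
near \oo => n.
have hn : (n0 <= n)%N by near: n; exact: nbhs_infty_ge.
have -> : ampliation (superop_exp Psi) X - Y =
    (exp_partial (ampliation Psi) n X - Y) +
    (ampliation (superop_exp Psi) X - exp_partial (ampliation Psi) n X).
  by rewrite [RHS]addrC addrA subrK.
apply: le_trans (trnormD _ _) _; apply: lerD; first exact: hn0.
apply: (@le_trans _ _ (e * K)).
  apply: trnorm_le_entries => s t.
  rewrite addmxE oppmxE ampliationE.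
  have -> : exp_partial (ampliation Psi) n X s t = (\sum_(m < n)
      w (tagnat.sig1 s) (tagnat.sig1 t) m) (tagnat.sig2 s) (tagnat.sig2 t).
    rewrite !summxE; apply: eq_bigr => m _.
    by rewrite -ampliation_iter !scalemxE ampliationE.
  by move: (tagnat.sig1 s) (tagnat.sig1 t) (tagnat.sig2 s) (tagnat.sig2 t);
    near: n.
by rewrite /e mulrAC ler_pdivrMr // ler_pM2l // lerDl.
Unshelve. all: by end_near.
Qed.

End SuperopExp.

(** * The diamond norm bound *)

Section DiamondNorm.
Variables (R : realType) (N : nat).
Local Notation C := R[i].
Local Notation D := (\sum_(_ < N) N)%N.

Lemma trnorm0 k : trnorm (0 : 'M[C]_k) = 0.
Proof.
apply/eqP; rewrite eq_le trnorm_ge0 andbT.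
by have := @trnormZ_le R k 0 0 0; rewrite scale0r mul0r normr0 lexx; exact.
Qed.

Lemma bounded_by_unit k (f : 'M[C]_k -> 'M[C]_k) (c : R) : linear f ->
  (forall X, trnorm X = 1 -> trnorm (f X) <= c) ->
  bounded_by (@trnorm R k) f c.
Proof.
move=> fl h X.
have f0 : f 0 = 0.
  have := fl 1 0 0; rewrite !scale1r addr0 => /eqP.
  by rewrite -subr_eq0 opprD addrA subrr add0r oppr_eq0 => /eqP.
have fZ a Y : f (a *: Y) = a *: f Y.
  by rewrite -[a *: Y]addr0 fl f0 addr0.
have [X0|X0] := eqVneq (trnorm X) 0.
  by rewrite (trnorm_eq0 X0) f0 trnorm0 mulr0.
have t0 : 0 < trnorm X by rewrite lt0r X0 trnorm_ge0.
set t := trnorm X in X0 t0 *.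
have ti0 : 0 <= t^-1 by rewrite invr_ge0 ltW.
have XE : X = t%:C%C *: ((t^-1)%:C%C *: X).
  by rewrite scalerA -rmorphM mulfV // scale1r.
have X1 : trnorm ((t^-1)%:C%C *: X) = 1.
  apply/eqP; rewrite eq_le; apply/andP; split.
    apply: le_trans (trnormZ_le _ (norm_real_le ti0)) _.
    by rewrite -/t mulVf.
  have := trnormZ_le ((t^-1)%:C%C *: X) (norm_real_le (ltW t0)).
  by rewrite -XE -/t -{1}[t]mulr1 ler_pM2l.
rewrite XE fZ; apply: le_trans (trnormZ_le _ (norm_real_le (ltW t0))) _.
by rewrite [c * t]mulrC; apply: ler_wpM2l; [exact: ltW | exact: h].
Qed.

Lemma diamond_norm_le (Phi : superop R N) (c : R) :
  (diamond_norm Phi <= c%:E)%E <->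
  (forall X : 'M[C]_D, trnorm X = 1 -> trnorm (ampliation Phi X) <= c).
Proof.
split=> [h X X1|h].
  by rewrite -lee_fin; apply: le_trans h; apply: ereal_sup_ubound; exists X.
by apply: ge_ereal_sup => _ [X X1 <-]; rewrite lee_fin; exact: h.
Qed.

End DiamondNorm.

(** * The averaged channel and the averaged generator *)

Section RandomizedLindblad.
Variables (R : realType) (N : nat) (d : measure_display) (A : measurableType d).
Variables (mu : probability A R) (H V : A -> 'M[R[i]]_N) (F : A -> superop R N).
Variables (lambda tau epsilon : R).
Local Notation C := R[i].
Local Notation D := (\sum_(_ < N) N)%N.
Local Notation p := (@trnorm R D).
Local Notation L := (fun a => lindblad (H a) (V a)).
Local Notation Lbar := (superop_mean mu L).
Local Notation Fbar := (superop_mean mu F).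

Hypothesis H_herm : forall a, H a \is hermsymmx.
Hypothesis L_meas : measurable_superop L.
Hypothesis lambda_gt0 : 0 < lambda.
Hypothesis H_bound : forall a, (opnorm (H a) <= lambda%:E)%E.
Hypothesis V_bound : forall a, (opnorm (V a) ^+ 2 <= lambda%:E)%E.
Hypothesis F_channel : forall a, quantum_channel (F a).
Hypothesis F_meas : measurable_superop F.
Hypothesis tau_gt0 : 0 < tau.
Hypothesis F_close : forall a,
  (diamond_norm (F a \- evolution tau (L a))%R <= epsilon%:E)%E.

Let H_adj a : (H a)^t* = H a.
Proof. by have /is_hermitianmxP := H_herm a; rewrite expr0 scale1r => <-. Qed.

Let sqH a : sq_bounded (\mxdiag_(_ < N) H a) (lambda ^+ 2).
Proof. by apply/sq_bounded_mxdiag/opnorm_sq_bounded => //; exact: ltW. Qed.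

Let sqV a : sq_bounded (\mxdiag_(_ < N) V a) lambda.
Proof. exact/sq_bounded_mxdiag/opnorm_sqr_sq_bounded. Qed.

Let dH_adj a : (\mxdiag_(_ < N) H a)^t* = \mxdiag_(_ < N) H a.
Proof. by rewrite adj_mxdiag H_adj. Qed.

Lemma generator_bounded a : bounded_by p (ampliation (L a)) (8 * lambda).
Proof. by move=> X; rewrite ampliation_lindblad; exact: trnorm_lindblad. Qed.

Lemma generator_euler_bounded a s X : 0 <= s ->
  p (X + s%:C%C *: ampliation (L a) X) <=
  (1 + 6 * lambda ^+ 2 * s ^+ 2) * p X.
Proof. by move=> s0; rewrite ampliation_lindblad; exact: trnorm_lindblad_euler. Qed.

Lemma generator_linear a : linear (ampliation (k := N) (L a)).
Proof. exact/ampliation_linear/lindblad_linear. Qed.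

Lemma channel_linear a : linear (ampliation (k := N) (F a)).
Proof. by apply: ampliation_linear; case: (F_channel a). Qed.

Let b := 8 * (lambda * tau).

Let b_ge0 : 0 <= b.
Proof. by rewrite !mulr_ge0 // ltW. Qed.

Lemma generator_scaled_bounded a :
  bounded_by p (ampliation (tau%:C%C \*: L a)%R) b.
Proof.
move=> X; rewrite ampliationZ.
apply: le_trans (trnormZ_le _ (norm_real_le (ltW tau_gt0))) _.
have -> : b * p X = tau * (8 * lambda * p X) by rewrite /b; ring.
by rewrite ler_pM2l // generator_bounded.
Qed.

Lemma evolution_remainder a X :
  p (ampliation (evolution tau (L a)) X - (X + tau%:C%C *: ampliation (L a) X))
  <= b ^+ 2 * expR b * p X.
Proof.
have lin : linear (ampliation (k := N) (tau%:C%C \*: L a)%R).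
  move=> c Y Z; rewrite !ampliationZ generator_linear scalerDr !scalerA.
  by rewrite mulrC.
pose f : {linear 'M[C]_D -> 'M[C]_D} := HB.pack
  (ampliation (k := N) (tau%:C%C \*: L a)%R) (GRing.isLinear.Build _ _ _ _ _ lin).
have fb : bounded_by p f b by exact: generator_scaled_bounded.
apply: (trnorm_superop_exp b_ge0 fb); exists 2 => n n2.
(* A single Euler step is [1 + tau L], whence [K = 1]. *)
have := exp_partial_euler (@trnorm_ge0 R D) (@trnormD R D) (@trnormZ_le R D)
  (K := 1) X b_ge0 fb n2.
by rewrite /= /euler !invr1 mulr1 scale1r /f /= ampliationZ [expR b * _]mulrC.
Qed.

Let delta := epsilon + b ^+ 2 * expR b.

(** The exponential is inserted only at unit [X]. Homogeneity is used for [F - 1 - tau L], whose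
    linearity is immediate, so linearity of the limit defining [evolution] is not called for. *)
Lemma scheme_remainder a : bounded_by p (fun X =>
  ampliation (F a) X - X - tau%:C%C *: ampliation (L a) X) delta.
Proof.
apply: bounded_by_unit => [c X Y|X X1].
  rewrite channel_linear generator_linear !scalerDr !scalerN !opprD !scalerA.
  rewrite [tau%:C%C * c]mulrC.
  have zmod_id (Z : zmodType) (u u' v v' w w' : Z) :
      u + u' + (- v - v') + (- w - w') = u - v - w + (u' - v' - w').
    by rewrite (addrACA u u') (addrACA (u - v)).
  exact: zmod_id.
have -> : ampliation (F a) X - X - tau%:C%C *: ampliation (L a) X =
  (ampliation (F a) X - ampliation (evolution tau (L a)) X) +
  (ampliation (evolution tau (L a)) X - (X + tau%:C%C *: ampliation (L a) X)).
  by rewrite addrA subrK opprD addrA.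
apply: le_trans (trnormD _ _) _; apply: lerD.
  rewrite -ampliationB; exact: (diamond_norm_le _ _).1.
by have := evolution_remainder a X; rewrite X1 mulr1.
Qed.

Let F_bm X : bounded_measurable_mx (fun a => ampliation (k := N) (F a) X).
Proof.
apply: (ampliation_bounded_measurable (r := p X) F_meas) => a.
exact: (trnorm_channel X (F_channel a)).
Qed.

Let L_bm X : bounded_measurable_mx (fun a => ampliation (k := N) (L a) X).
Proof.
apply: (ampliation_bounded_measurable (r := 8 * lambda * p X) L_meas) => a.
exact: (generator_bounded a X).
Qed.

Lemma mean_channel_linear : linear (ampliation (k := N) Fbar).
Proof.
move=> c X Y; rewrite !ampliation_mean -mxmean_lin //; congr mxmean.
by apply/funext => a; rewrite channel_linear.
Qed.

Lemma mean_generator_linear : linear (ampliation (k := N) Lbar).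
Proof.
move=> c X Y; rewrite !ampliation_mean -mxmean_lin //; congr mxmean.
by apply/funext => a; rewrite generator_linear.
Qed.

Lemma mean_channel_bounded : bounded_by p (ampliation Fbar) 1.
Proof.
move=> X; rewrite mul1r ampliation_mean; apply: trnorm_mxmean (F_bm X) _ => a.
exact: (trnorm_channel X (F_channel a)).
Qed.

Lemma mean_generator_bounded : bounded_by p (ampliation Lbar) (8 * lambda).
Proof.
move=> X; rewrite ampliation_mean; apply: trnorm_mxmean (L_bm X) _ => a.
exact: (generator_bounded a X).
Qed.

(** As [mu] has mass one, [X] is its own mean, so the Euler step of the mean is the mean of the
    Euler steps. *)
Lemma mean_generator_euler_bounded s X : 0 <= s ->
  p (X + s%:C%C *: ampliation Lbar X) <=
  (1 + 6 * lambda ^+ 2 * s ^+ 2) * p X.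
Proof.
move=> s0; rewrite ampliation_mean -{1}[X](mxmean_cst mu) addrC -mxmean_lin //;
  last exact: bounded_measurable_mx_cst.
apply: trnorm_mxmean => [|a].
  by apply: bounded_measurable_mx_lin => //; exact: bounded_measurable_mx_cst.
by rewrite addrC; exact: generator_euler_bounded.
Qed.

Lemma mean_scheme_remainder : bounded_by p (fun X =>
  ampliation Fbar X - X - tau%:C%C *: ampliation Lbar X) delta.
Proof.
move=> X.
have cst := @bounded_measurable_mx_cst R d A D X.
have b1 := bounded_measurable_mx_lin (-1) cst (F_bm X).
have -> : ampliation Fbar X - X - tau%:C%C *: ampliation Lbar X =
  mxmean mu (fun a => - tau%:C%C *: ampliation (L a) X +
    (-1 *: X + ampliation (F a) X)).
  rewrite (mxmean_lin _ _ (L_bm X) b1) (mxmean_lin _ _ cst (F_bm X)) mxmean_cst.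
  by rewrite -!ampliation_mean scaleN1r scaleNr addrC [- X + _]addrC.
apply: trnorm_mxmean => [|a]; first exact: bounded_measurable_mx_lin.
have := scheme_remainder a X.
by rewrite scaleN1r scaleNr addrC [- X + _]addrC.
Qed.

(** One [b ^+ 2 * expR b], inside [delta], stems from the individual evolutions; the other from the
    Euler product of the mean generator. *)
Lemma randomized_lindblad_bound M : (1 <= M)%N -> 0 <= epsilon ->
  (diamond_norm (iter M Fbar \- evolution (tau * M%:R) Lbar)%R <=
   (M%:R * (delta + b ^+ 2 * expR b) * expR 1)%:E)%E.
Proof.
move=> M1 eps0; apply/diamond_norm_le => X X1.
have lin : linear (fun X : 'M[C]_D => tau%:C%C *: ampliation Lbar X).
  move=> c Y Z; rewrite mean_generator_linear scalerDr !scalerA.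
  by rewrite [tau%:C%C * c]mulrC.
pose f : {linear 'M[C]_D -> 'M[C]_D} := HB.pack
  (fun X : 'M[C]_D => tau%:C%C *: ampliation Lbar X)
  (GRing.isLinear.Build _ _ _ _ _ lin).
have fb : bounded_by p f b.
  move=> Y; apply: le_trans (trnormZ_le _ (norm_real_le (ltW tau_gt0))) _.
  have -> : b * p Y = tau * (8 * lambda * p Y) by rewrite /b; ring.
  by rewrite ler_pM2l // mean_generator_bounded.
have Fadd : zmod_morphism (ampliation (k := N) Fbar).
  move=> Y Z; have := mean_channel_linear (-1) Z Y.
  by rewrite !scaleN1r ![- _ + _]addrC.
have d0 : 0 <= delta.
  by rewrite addr_ge0 // mulr_ge0 ?expR_ge0 // sqr_ge0.
(* [f] contains the factor [tau], so a step [s] of [f] is a step [s * tau] of the mean generator. *)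
have fe s : 0 <= s -> bounded_by p (euler f s)
    (1 + 6 * lambda ^+ 2 * tau ^+ 2 * s ^+ 2).
  move=> s0 Y; rewrite /euler /f /= scalerA -rmorphM.
  apply: le_trans (mean_generator_euler_bounded _ _) _.
    by rewrite mulr_ge0 // ltW.
  by rewrite exprMn [s ^+ 2 * _]mulrC !mulrA.
have c0 : 0 <= 6 * lambda ^+ 2 * tau ^+ 2.
  by apply: mulr_ge0 (sqr_ge0 _); apply: mulr_ge0 => //; exact: sqr_ge0.
apply/ler_addgt0Pr => eps e0.
have Fd : bounded_by p (fun x => ampliation Fbar x - x - f x) delta.
  by move=> Y; exact: (mean_scheme_remainder Y).
have cb := @chernoff_bound R _ p (@trnorm_ge0 R D) (@trnormD R D)
  (@trnormZ_le R D) f (ampliation Fbar) b (6 * lambda ^+ 2 * tau ^+ 2) delta eps M.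
have {cb} := cb Fadd mean_channel_bounded.
move=> /(_ d0 Fd b_ge0 fb c0 fe M1 e0) [n0 hn0].
rewrite ampliationB ampliation_iter -opprB.
apply: le_trans (seminormN_le (@trnormZ_le R D) _) _.
have PsiE : ampliation (k := N) ((tau * M%:R)%:C%C \*: Lbar)%R =
    ((M%:R : C) \*: f)%R.
  apply/funext => Y; rewrite ampliationZ /f /= scalerA.
  by rewrite rmorphM rmorph_nat mulrC.
have Psib : bounded_by p (ampliation (k := N) ((tau * M%:R)%:C%C \*: Lbar)%R)
    (M%:R * b).
  move=> Y; rewrite PsiE /= -mulrA.
  apply: le_trans (@trnormZ_le _ _ _ M%:R _ _) _.
    by rewrite rmorph_nat normr_nat.
  by rewrite ler_wpM2l // fb.
apply: (trnorm_superop_exp _ Psib); first by rewrite mulr_ge0.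
exists n0 => n hn; rewrite PsiE -opprB.
apply: le_trans (seminormN_le (@trnormZ_le R D) _) _.
by have := hn0 n hn X; rewrite X1 mulr1.
Qed.

End RandomizedLindblad.

Unset Implicit Arguments.

Theorem theorem4 (R : realType) (c0 C0 : R) (hc0 : 0 < c0) (hC0 : 0 < C0) :
  exists2 C : R, 0 < C &
  forall (n : nat) (d : measure_display) (A : measurableType d)
    (mu : probability A R)
    (H V : A -> 'M[R[i]]_(2 ^ n)%N) (F : A -> superop R (2 ^ n)%N)
    (lambda tau T : R) (M : nat),
  let L := fun a : A => lindblad (H a) (V a) in
  (forall a, H a \is hermsymmx) ->
  measurable_superop L ->
  0 < lambda ->
  (forall a, (opnorm (H a) <= lambda%:E)%E) ->
  (forall a, (opnorm (V a) ^+ 2 <= lambda%:E)%E) ->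
  (forall a, quantum_channel (F a)) ->
  measurable_superop F ->
  0 < tau -> tau <= c0 * lambda^-1 ->
  (forall a, (diamond_norm (F a \- evolution tau (L a))%R
              <= (C0 * lambda ^+ 2 * tau ^+ 2)%:E)%E) ->
  (1 <= M)%N -> T = tau * M%:R ->
  (diamond_norm (iter M (superop_mean mu F) \- evolution T (superop_mean mu L))%R
   <= (C * (lambda ^+ 2 * T ^+ 2 / M%:R))%:E)%E.
Proof.
(* 128 is twice 64: with [b = 8 lambda tau], each of the two remainders is
   [64 (lambda tau)^2 expR b], and [b <= 8 c0]. The factor [expR 1] bounds the powers of the Euler
   product. *)
exists ((C0 + 128 * expR (8 * c0)) * expR 1).
  by rewrite mulr_gt0 ?expR_gt0 // addr_gt0 // mulr_gt0 ?expR_gt0.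
move=> n d A mu H V F lambda tau T M L Hh Lm l0 Hb Vb Fc Fm t0 tc Fcl M1 TE.
have lt_ge0 : 0 <= lambda * tau by rewrite mulr_ge0 // ltW.
have lt_c0 : lambda * tau <= c0 by rewrite mulrC -ler_pdivlMr.
have M0 : 0 < M%:R :> R by rewrite ltr0n.
have eps0 : 0 <= C0 * lambda ^+ 2 * tau ^+ 2.
  by apply: mulr_ge0 (sqr_ge0 _); apply: mulr_ge0 (sqr_ge0 _); exact: ltW.
have bound := 
  randomized_lindblad_bound mu Hh Lm l0 Hb Vb Fc Fm t0 Fcl M1 eps0.
rewrite TE; apply: le_trans bound _.
rewrite lee_fin.
have -> : lambda ^+ 2 * (tau * M%:R) ^+ 2 / M%:R = M%:R * (lambda * tau) ^+ 2.
  by field; rewrite gt_eqF.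
rewrite [leRHS]mulrAC; apply: ler_wpM2r; first exact: expR_ge0.
rewrite [leRHS]mulrCA; apply: ler_wpM2l; first exact: ltW.
have e8 : expR (8 * (lambda * tau)) <= expR (8 * c0) by rewrite ler_expR ler_pM2l.
have sq0 := sqr_ge0 (lambda * tau).
have := ler_wpM2l sq0 e8; rewrite !exprMn; nra.
Qed.
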